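(* Let $\Gamma\subset SL_2(\mathbb R)$ be a lattice, $k\in\mathbb R$, $K\in\mathbb Z$, and let $a_0,\dots,a_n$ be holomorphic functions on $\mathfrak H$. Then $L=\sum_{r=0}^n a_r(\tau)D^r$ is a modular linear differential operator of type $(k,k+K)$ on $\Gamma$ if and only if $$\bigl(a_r|_{K-2r}\gamma\bigr)(\tau)=\sum_{j=0}^{n-r}\binom{r+j}{j}(k+r)_j\Bigl(-\frac1{2\pi i}\frac{c}{c\tau+d}\Bigr)^j a_{r+j}(\tau)$$ for all $0\le r\le n$, all $\tau\in\mathfrak H$ and all $\gamma=\begin{pmatrix}a&b\\c&d\end{pmatrix}\in\Gamma$.
   Context: A lattice is a discrete subgroup of $SL_2(\mathbb R)$ of finite covolume acting on the upper half-plane $\mathfrak H$ by fractional linear transformations. $(f|_k\gamma)(\tau)=(c\tau+d)^{-k}f\bigl(\frac{a\tau+b}{c\tau+d}\bigr)$; $D=\frac1{2\pi i}\frac d{d\tau}$; $(x)_j=x(x+1)\cdots(x+j-1)$. A modular linear differential operator of type $(k,k+K)$ on $\Gamma$ is a linear differential operator of finite order with coefficients holomorphic on $\mathfrak H$ (and at the cusps in the usual sense) such that $L(f|_k\gamma)=L(f)|_{k+K}\gamma$ for all holomorphic $f$ on $\mathfrak H$ and all $\gamma\in\Gamma$.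
   Formalization: Since the transformation law does not force holomorphy at the cusps (e.g. n=0, k=K=0, a_0=j), L is shown to be an MLDO iff the law holds and each a_r is holomorphic at the cusps in weight K-2r; without the cusp condition, equivariance of L is shown equivalent to the law alone. *)

(* Defs.v *)
(* MathComp-Analysis, over an arbitrary R : realType. *)
From HB Require Import structures.
From mathcomp Require Import all_boot all_order all_algebra.
From mathcomp Require Import all_classical all_reals all_analysis.
From mathcomp.real_closed Require Import complex.

Set Implicit Arguments.
Unset Strict Implicit.
Unset Printing Implicit Defensive.

Import Order.TTheory GRing.Theory Num.Theory.
Import numFieldNormedType.Exports.

Local Open Scope classical_set_scope.
Local Open Scope ring_scope.

(* R[i], packaged as a numClosedFieldType so that the topology and the
   derivatives of MathComp-Analysis, which are defined over any numFieldType,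
   apply to functions Cplx R -> Cplx R.  [derivable f z 1] is then complex
   differentiability at z, and [derive1 f] the complex derivative. *)
Definition Cplx (R : realType) : numClosedFieldType := R[i].

Section UpperHalfPlane.
Variable R : realType.
Local Notation C := (Cplx R).
Implicit Types (x y k w : R) (K : int) (z tau : C) (f : C -> C).
Implicit Types (g sigma : 'M[R]_2) (G : set 'M[R]_2).

Definition re z : R := complex.Re z.
Definition im z : R := complex.Im z.
Definition mkC x y : C := (x +i* y)%C.
Definition toC x : C := mkC x 0.
Definition modulus z : R := re `|z|.

(* The complex power functions are not in the library. *)

Definition cexp z : C := toC (expR (re z)) * mkC (cos (im z)) (sin (im z)).

(* Principal argument: it lies in ]-pi, pi] for z != 0. *)
Definition carg z : R :=
  if 0 <= im z then acos (re z / modulus z) else - acos (re z / modulus z).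

Definition clog z : C := mkC (ln (modulus z)) (carg z).

(* Principal value of z ^ w for z != 0 and a real exponent w; it is the usual
   power when w is an integer. *)
Definition cpow z w : C := cexp (toC w * clog z).

Definition upper : set C := [set tau | 0 < im tau].

(* Functions on the upper half-plane are represented by total functions on C,
   of which only the values on [upper] matter. *)
Definition holomorphic_upper f : Prop :=
  forall tau, upper tau -> derivable f tau 1.

Definition automorphy g tau : C := toC (g 1 0) * tau + toC (g 1 1).

Definition mobius g tau : C :=
  (toC (g 0 0) * tau + toC (g 0 1)) / automorphy g tau.

(* (f |_w g)(tau) for a real weight w.  On [upper] the factor c tau + d is
   either constant or non-real, so that the principal branch is holomorphic
   there. *)
Definition slash w f g : C -> C :=
  fun tau => cpow (automorphy g tau) (- w) * f (mobius g tau).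

(* Area for dx dy / y^2 of a set of points x + i y. *)
Definition hyperbolic_area (F : set (R * R)) : \bar R :=
  (\int[(@lebesgue_measure R) \x (@lebesgue_measure R)]_(p in F)
     ((p.2 ^+ 2)^-1)%:E)%E.

Definition subgroup_SL2 G : Prop :=
  [/\ forall g, G g -> \det g = 1,
      G 1,
      forall g h, G g -> G h -> G (g * h) &
      forall g, G g -> G (g^-1)].

(* F is a Borel set of representatives for the orbits of G on [upper]. *)
Definition fundamental_set G (F : set (R * R)) : Prop :=
  [/\ measurable F,
      F `<=` [set p | upper (mkC p.1 p.2)] &
      forall tau, upper tau ->
        exists! p, F p /\ exists2 g, G g & mobius g tau = mkC p.1 p.2].

Definition lattice G : Prop :=
  [/\ subgroup_SL2 G,
      (forall g, G g -> isolated G g) &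
      exists2 F, fundamental_set G F & (hyperbolic_area F < +oo)%E].

Definition parabolic g : Prop := [/\ g <> 1, g <> -1 & `|\tr g| = 2].

(* sigma in SL_2(R) maps the point oo to a cusp of G, i.e., to a point fixed by
   some parabolic element of G. *)
Definition cusp_chart G sigma : Prop :=
  \det sigma = 1 /\
  exists g, [/\ G g, parabolic g & (sigma^-1 * g * sigma) 1 0 = 0].

(* f |_w sigma stays bounded as Im tau -> oo, for each sigma mapping oo to a
   cusp.  For a modular, or more generally quasimodular, form f of weight w
   this says that no negative powers occur in its q-expansions. *)
Definition holomorphic_at_cusps G w f : Prop :=
  forall sigma, cusp_chart G sigma ->
    exists A M, forall tau, A < im tau -> modulus (slash w f sigma tau) <= M.

Definition twopii : C := mkC 0 (2 * pi).

Definition D f : C -> C := fun tau => twopii^-1 * derive1 f tau.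

Definition diff_op (n : nat) (a : nat -> C -> C) f : C -> C :=
  fun tau => \sum_(r < n.+1) a r tau * iter r D f tau.

Definition equivariant G k K (L : (C -> C) -> (C -> C)) : Prop :=
  forall f g, holomorphic_upper f -> G g -> forall tau, upper tau ->
    L (slash k f g) tau = slash (k + K%:~R) (L f) g tau.

(* The r-th coefficient behaves like a (quasi)modular form of weight K - 2r, and
   it is with this weight that it has to be holomorphic at the cusps. *)
Definition mldo G k K (L : (C -> C) -> (C -> C)) : Prop :=
  (exists n (a : nat -> C -> C),
     [/\ forall r, (r <= n)%N -> holomorphic_upper (a r),
         forall r, (r <= n)%N ->
           holomorphic_at_cusps G (K - 2 * r%:Z)%:~R (a r) &
         forall f, holomorphic_upper f -> forall tau, upper tau ->
           L f tau = diff_op n a f tau]) /\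
  equivariant G k K L.

Definition rising x (j : nat) : R := \prod_(i < j) (x + i%:R).

Definition coefficient_law G k K (n : nat) (a : nat -> C -> C) : Prop :=
  forall r, (r <= n)%N -> forall tau, upper tau -> forall g, G g ->
    slash (K - 2 * r%:Z)%:~R (a r) g tau =
    \sum_(j < (n - r).+1)
       'C(r + j, j)%:R * toC (rising (k + r%:R) j) *
       (- (twopii^-1 * (toC (g 1 0) / automorphy g tau))) ^+ j *
       a (r + j)%N tau.

End UpperHalfPlane.

(* Main.v *)
Require Import Defs.
From HB Require Import structures.
From mathcomp Require Import all_boot all_order all_algebra.
From mathcomp Require Import all_classical all_reals all_analysis.
From mathcomp.real_closed Require Import complex.
From mathcomp Require Import ring lra.

Set Implicit Arguments.
Unset Strict Implicit.
Unset Printing Implicit Defensive.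

Import Order.TTheory GRing.Theory Num.Theory.
Import numFieldNormedType.Exports.

Local Open Scope classical_set_scope.
Local Open Scope ring_scope.

(* Write J = c tau + d, kappa = 1/(2 pi i) and X = - kappa c / J.  Since
   D X = X^2, D J^(-w) = w X J^(-w) and D (h o g) = J^(-2) (D h) o g, induction
   on m gives
     D^m (f|_k g) = sum_r C(m,r) (k+r)_(m-r) X^(m-r) J^(-k-2r) (D^r f) o g.
   Hence both L (f|_k g) and (L f)|_(k+K) g are combinations of the numbers
   (D^r f)(g tau), and the coefficients agree exactly when the coefficient law
   holds; conversely f = (z - g tau)^r isolates the r-th coefficient.  The same
   polynomials show that an operator determines its coefficients, which gives
   the statement on cusps.

   The formula requires D^r f to be differentiable for every pointwise
   differentiable f.  By Goursat's theorem on rectangles applied to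
   s |-> (q(a + e^s) - q(a)) e^(-s), which is 2 pi i-periodic, the mean of this
   function over a vertical period does not depend on Re s; letting
   Re s -> -oo identifies it with q'(a).  The resulting estimate of q'(a) by
   the oscillation of q, applied to q = f, then to differences of translates of
   f, then to differences of difference quotients of f, shows in turn that f'
   is locally bounded, locally Lipschitz and differentiable. *)

(** * Complex modulus and derivatives *)

Section ComplexModulus.
Variable R : realType.
Local Notation C := (Cplx R).
Implicit Types (x y t : R) (z w l : C) (f g : C -> C).

Lemma normCplx z : `|z| = toC (modulus z).
Proof. by rewrite /modulus /toC /mkC /re normc_def. Qed.

Lemma toCD x y : toC (x + y) = toC x + toC y.
Proof. by apply/eqP; rewrite eq_complex /= addr0 !eqxx. Qed.

Lemma toCM x y : toC (x * y) = toC x * toC y.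
Proof. by apply/eqP; rewrite eq_complex /= !mul0r !mulr0 !(subr0, addr0) !eqxx. Qed.

Lemma toCN x : toC (- x) = - toC x.
Proof. by apply/eqP; rewrite eq_complex /= oppr0 !eqxx. Qed.

Lemma toC_inj : injective (@toC R).
Proof. by move=> x y []. Qed.

Lemma toC0 : toC 0 = 0 :> C. Proof. by []. Qed.
Lemma toC1 : toC 1 = 1 :> C. Proof. by []. Qed.

Lemma toC_nat n : toC n%:R = n%:R :> C.
Proof. by elim: n => // n IH; rewrite -addn1 !natrD toCD IH. Qed.

Lemma toC_le x y : (toC x <= toC y) = (x <= y).
Proof. by rewrite lecR. Qed.

Lemma toC_lt x y : (toC x < toC y) = (x < y).
Proof. by rewrite ltcR. Qed.

Lemma toCV x : toC x^-1 = (toC x)^-1.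
Proof.
have [->|x0] := eqVneq x 0; first by rewrite toC0 !invr0.
have x0' : toC x != 0 by apply: contra_neq x0 => /toC_inj.
by apply: (mulfI x0'); rewrite -toCM !divff.
Qed.

Lemma modulusM z w : modulus (z * w) = modulus z * modulus w.
Proof. by apply: toC_inj; rewrite toCM -!normCplx normrM. Qed.

Lemma modulusD z w : modulus (z + w) <= modulus z + modulus w.
Proof. by rewrite -toC_le toCD -!normCplx ler_normD. Qed.

Lemma modulusN z : modulus (- z) = modulus z.
Proof. by rewrite /modulus normrN. Qed.

Lemma modulusB z w : modulus (z - w) <= modulus z + modulus w.
Proof. by rewrite -(modulusN w) modulusD. Qed.

Lemma modulusC z w : modulus (z - w) = modulus (w - z).
Proof. by rewrite -modulusN opprB. Qed.

Lemma modulusV z : modulus z^-1 = (modulus z)^-1.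
Proof. by apply: toC_inj; rewrite toCV -!normCplx normfV. Qed.

Lemma modulus_ge0 z : 0 <= modulus z.
Proof. by rewrite -toC_le -normCplx; exact: normr_ge0. Qed.

Lemma modulus_gt0 z : (0 < modulus z) = (z != 0).
Proof. by rewrite -toC_lt -normCplx -normr_gt0. Qed.

Lemma modulus0 : modulus (0 : C) = 0.
Proof. by rewrite /modulus normr0. Qed.

Lemma modulus0_eq z : modulus z = 0 -> z = 0.
Proof. by move=> z0; apply/eqP; rewrite -normr_eq0 normCplx z0. Qed.

Lemma modulusE z : modulus z = Num.sqrt (re z ^+ 2 + im z ^+ 2).
Proof. by rewrite /modulus normc_def. Qed.

Lemma modulus_toC x : modulus (toC x) = `|x|.
Proof. by rewrite modulusE /= expr0n /= addr0 sqrtr_sqr. Qed.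

Lemma abs_re_le z : `|re z| <= modulus z.
Proof.
by rewrite modulusE -sqrtr_sqr ler_sqrt ?lerDl ?sqr_ge0 // addr_ge0 ?sqr_ge0.
Qed.

Lemma abs_im_le z : `|im z| <= modulus z.
Proof.
by rewrite modulusE -sqrtr_sqr ler_sqrt ?lerDr ?sqr_ge0 // addr_ge0 ?sqr_ge0.
Qed.

Lemma modulus_i : modulus (mkC 0 1 : C) = 1.
Proof. by rewrite modulusE /= expr0n /= add0r expr1n sqrtr1. Qed.

Lemma modulus_le z : modulus z <= `|re z| + `|im z|.
Proof.
have E : z = toC (re z) + mkC 0 1 * toC (im z).
  apply/eqP; rewrite eq_complex /=; apply/andP; split; apply/eqP; rewrite /re /im; ring.
by rewrite {1}E (le_trans (modulusD _ _)) // modulusM modulus_i mul1r !modulus_toC.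
Qed.

Lemma reD z w : re (z + w) = re z + re w. Proof. by case: z w => [? ?] []. Qed.
Lemma imD z w : im (z + w) = im z + im w. Proof. by case: z w => [? ?] []. Qed.
Lemma reN z : re (- z) = - re z. Proof. by case: z. Qed.
Lemma imN z : im (- z) = - im z. Proof. by case: z. Qed.
Lemma reM z w : re (z * w) = re z * re w - im z * im w.
Proof. by case: z w => [? ?] []. Qed.
Lemma imM z w : im (z * w) = re z * im w + im z * re w.
Proof. by case: z w => [? ?] []. Qed.

Lemma Cplx_ext z w : re z = re w -> im z = im w -> z = w.
Proof. by case: z w => [? ?] [? ?] /= -> ->. Qed.

Lemma im_mkC x y : im (mkC x y) = y. Proof. by []. Qed.
Lemma re_mkC x y : re (mkC x y) = x. Proof. by []. Qed.
Lemma mkC_reim z : mkC (re z) (im z) = z. Proof. by case: z. Qed.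

(** Radii of balls in [C] are themselves elements of [C], but positivity in its order forces them to
    be real, so the real part of a radius serves as [d]. *)
Lemma nbhs_CplxP z (P : set C) :
  nbhs z P <-> exists2 d : R, 0 < d & forall w, modulus (w - z) < d -> P w.
Proof.
split=> [/nbhs_ballP [e /= e0 eP]|[d d0 dP]].
  have eE : e = toC (re e).
    by rewrite /toC /mkC /re -{1}(RRe_real (gtr0_real e0)).
  exists (re e); first by rewrite -toC_lt -eE.
  move=> w we; apply: eP.
  by rewrite -ball_normE /ball_ /= normCplx modulusC eE toC_lt.
apply/nbhs_ballP; exists (toC d) => /=; first by rewrite toC_lt.
move=> w; rewrite -ball_normE /ball_ /= normCplx toC_lt modulusC; exact: dP.
Qed.

Lemma scale_one (K : numFieldType) (h : K) : h *: (1 : K) = h.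
Proof. exact: mulr1. Qed.

(* The norm of C takes its values in C; here epsilon and delta are real. *)
Definition has_derivative f z l : Prop :=
  forall e, 0 < e -> exists2 d : R, 0 < d & forall w, modulus (w - z) < d ->
    modulus (f w - f z - l * (w - z)) <= e * modulus (w - z).

(** Multiplying the difference quotient by [w - z] turns the punctured limit into an inequality
    without division, which is trivial at [w = z]. *)
Lemma is_derive_CplxP f z l : is_derive z 1 f l <-> has_derivative f z l.
Proof.
have key : (fun h : C => h^-1 *: (f (h *: 1 + z) - f z)) @ (0 : C)^' --> l <->
           has_derivative f z l.
  split.
    move/cvgrPdist_le => H e e0.
    have := H (toC e); rewrite toC_lt => /(_ e0).
    rewrite near_withinE => /nbhs_CplxP [d d0 dP]; exists d => // w wd.
    have [->|wz] := eqVneq w z; first by rewrite !subrr mulr0 subrr modulus0 mulr0.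
    have wz' : w - z != 0 by rewrite subr_eq0.
    have := dP (w - z); rewrite subr0 => /(_ wd wz').
    rewrite normCplx toC_le scale_one subrK => {}dP.
    have -> : f w - f z - l * (w - z) = - ((l - (w - z)^-1 * (f w - f z)) * (w - z)).
      by field.
    by rewrite modulusN modulusM ler_wpM2r // modulus_ge0.
  move=> H; apply/cvgrPdist_le => e e0.
  have eE : e = toC (re e).
    by rewrite /toC /mkC /re -{1}(RRe_real (gtr0_real e0)).
  have e0' : 0 < re e by rewrite -toC_lt -eE.
  have [d d0 dP] := H _ e0'.
  rewrite near_withinE; apply/nbhs_CplxP; exists d => // h hd h0.
  rewrite normCplx eE toC_le scale_one.
  have := dP (h + z); rewrite addrK; rewrite subr0 in hd => /(_ hd) {}dP.
  have -> : l - h^-1 *: (f (h + z) - f z) = - h^-1 * (f (h + z) - f z - l * h).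
    by rewrite /GRing.scale /=; field.
  by rewrite modulusM modulusN modulusV ler_pdivrMl ?modulus_gt0 // (mulrC _ (re e)).
split=> [[df dl]|H].
  by apply/key; rewrite -dl; exact: df.
have {}H := key.2 H.
split; first by apply/cvg_ex; exists l.
exact: (cvg_lim _ H).
Qed.

Lemma has_derivative_continuous f z l : has_derivative f z l ->
  forall e, 0 < e -> exists2 d : R, 0 < d & forall w, modulus (w - z) < d ->
    modulus (f w - f z) < e.
Proof.
move=> H e e0; have [d d0 dP] := H 1 ltr01.
have M0 : 0 < 1 + modulus l by rewrite ltr_pwDl // modulus_ge0.
exists (Num.min d (e / (1 + modulus l))); first by rewrite lt_min d0 divr_gt0.
move=> w; rewrite lt_min ltr_pdivlMr // => /andP[/dP H1 H2].
apply: le_lt_trans H2; rewrite mulrDr mulr1.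
rewrite -(subrK (l * (w - z)) (f w - f z)).
apply: (le_trans (modulusD _ _)); rewrite modulusM (mulrC (modulus l)) lerD2r.
by rewrite mul1r in H1.
Qed.

Lemma has_derivative_comp f g z l m :
  has_derivative g z l -> has_derivative f (g z) m ->
  has_derivative (f \o g) z (m * l).
Proof.
move=> Hg Hf e e0.
pose M := 1 + modulus l + modulus m.
have M1 : 1 <= M by rewrite /M; have := modulus_ge0 l; have := modulus_ge0 m; lra.
(* The remainder is at most [e1 * (e1 + modulus l + modulus m)] times [modulus (w - z)], and
   [e1 <= 1] bounds the bracket by [M]. *)
pose e1 := Num.min 1 (e / (2 * M)).
have M0 : 0 < M by lra.
have e10 : 0 < e1 by rewrite lt_min ltr01 divr_gt0 //; lra.
have e1M : e1 * (2 * M) <= e by rewrite -ler_pdivlMr ?ge_min ?lexx ?orbT //; lra.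
have [d1 d10 P1] := Hf _ e10.
have [d2 d20 P2] := Hg _ e10.
have [d3 d30 P3] := has_derivative_continuous Hg d10.
exists (Num.min d2 d3); first by rewrite lt_min d20.
move=> w; rewrite lt_min => /andP[/P2 H2 /P3 /P1 H1] /=.
set u := f (g w) - _ - _ in H1; set v := g w - _ - _ in H2.
have -> : f (g w) - f (g z) - m * l * (w - z) = u + m * v by rewrite /u /v; ring.
apply: (le_trans (modulusD _ _)); rewrite modulusM.
have E : g w - g z = v + l * (w - z) by rewrite /v; ring.
have H3 : modulus (g w - g z) <= (e1 + modulus l) * modulus (w - z).
  by rewrite E (le_trans (modulusD _ _)) // modulusM mulrDl lerD.
have e11 : e1 <= 1 by rewrite ge_min lexx.
have := modulus_ge0 (w - z); have := modulus_ge0 l; have := modulus_ge0 m.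
move: H1 H2 H3 e1M; rewrite /M.
move: (modulus u) (modulus v) (modulus l) (modulus m) (modulus (w - z))
  (modulus (g w - g z)) => U V L M' W G H1 H2 H3 H4 m0 l0 w0.
apply: le_trans (_ : e1 * ((e1 + L) * W) + M' * (e1 * W) <= _).
  apply: lerD; last by rewrite ler_wpM2l.
  by apply: (le_trans H1); rewrite ler_wpM2l // ltW.
have -> : e1 * ((e1 + L) * W) + M' * (e1 * W) = e1 * (e1 + L + M') * W by ring.
rewrite ler_wpM2r //; apply: le_trans H4; rewrite ler_wpM2l ?ltW //; lra.
Qed.

Lemma real_bound_is_derive (f : R -> R) (x l : R) :
  (forall e, 0 < e -> exists2 d : R, 0 < d & forall y, `|y - x| < d ->
     `|f y - f x - l * (y - x)| <= e * `|y - x|) -> is_derive x 1 f l.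
Proof.
move=> H.
suff K : (fun h : R => h^-1 *: (f (h *: 1 + x) - f x)) @ (0 : R)^' --> l.
  by split; [apply/cvg_ex; exists l | exact: (cvg_lim _ K)].
apply/cvgrPdist_le => e e0; have [d d0 dP] := H _ e0.
rewrite near_withinE; apply/nbhs_ballP; exists d => //= h.
rewrite -ball_normE /ball_ /= sub0r normrN => hd h0.
rewrite scale_one; have := dP (h + x); rewrite addrK => /(_ hd) {}dP.
have -> : l - h^-1 *: (f (h + x) - f x) = - h^-1 * (f (h + x) - f x - l * h).
  by rewrite /GRing.scale /=; field.
by rewrite normrM normrN normfV ler_pdivrMl ?normr_gt0 // (mulrC _ e).
Qed.

(** Restriction to a real line gives real functions of a real variable, to which the mean value
    theorem and the theory of primitives apply. *)
Lemma has_derivative_line f z u x l : has_derivative f (z + toC x * u) l ->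
  is_derive x 1 (fun t => re (f (z + toC t * u))) (re (l * u)) /\
  is_derive x 1 (fun t => im (f (z + toC t * u))) (im (l * u)).
Proof.
move=> H.
have E y : z + toC y * u - (z + toC x * u) = toC (y - x) * u.
  by rewrite toCD toCN; ring.
have K e : 0 < e -> exists2 d : R, 0 < d & forall y, `|y - x| < d ->
   modulus (f (z + toC y * u) - f (z + toC x * u) - toC (y - x) * (l * u)) <= e * `|y - x|.
  move=> e0; have M0 : 0 < 1 + modulus u by rewrite ltr_pwDl // modulus_ge0.
  have [d d0 dP] := H _ (divr_gt0 e0 M0).
  exists (d / (1 + modulus u)); first by rewrite divr_gt0.
  move=> y; rewrite ltr_pdivlMr // => yd.
  have := dP (z + toC y * u); rewrite E modulusM modulus_toC.
  have yy : `|y - x| * modulus u <= `|y - x| * (1 + modulus u).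
    by rewrite ler_wpM2l // lerDr.
  move=> /(_ (le_lt_trans yy yd)) {}dP.
  rewrite (_ : toC (y - x) * (l * u) = l * (toC (y - x) * u)); last by ring.
  apply: (le_trans dP).
  apply: le_trans (_ : e / (1 + modulus u) * (`|y - x| * (1 + modulus u)) <= _).
    by rewrite ler_wpM2l // ltW // divr_gt0.
  rewrite le_eqVlt; apply/orP; left; apply/eqP; field; exact: lt0r_neq0.
split; apply: real_bound_is_derive => e /K [d d0 dP]; exists d => // y /dP; apply: le_trans.
  set A := f _ - _ in dP *.
  have -> : re (f (z + toC y * u)) - re (f (z + toC x * u)) - re (l * u) * (y - x) =
    re (f (z + toC y * u) - f (z + toC x * u) - toC (y - x) * (l * u)).
    by rewrite !(reD, reN) (reM (toC _)) /= mul0r subr0 (mulrC (y - x)).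
  exact: abs_re_le.
have -> : im (f (z + toC y * u)) - im (f (z + toC x * u)) - im (l * u) * (y - x) =
    im (f (z + toC y * u) - f (z + toC x * u) - toC (y - x) * (l * u)).
  by rewrite !(imD, imN) (imM (toC _)) /= mul0r addr0 (mulrC (y - x)).
exact: abs_im_le.
Qed.

End ComplexModulus.

(** * Integrals of continuous functions *)

Section RealPrimitive.
Variable R : realType.
Implicit Types (a b c x t : R) (h g H : R -> R).
Local Notation mu := (@lebesgue_measure R).

Lemma increment_bound H h a b (M : R) : a <= b ->
  (forall x, a <= x <= b -> is_derive x 1 H (h x)) ->
  (forall x, a <= x <= b -> `|h x| <= M) ->
  `|H b - H a| <= M * (b - a).
Proof.
move=> ab dH hM.
have dcH : {within `[a, b], continuous H}.
  apply: derivable_within_continuous => x; rewrite in_itv /= => xab.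
  by have [] := dH _ xab.
have dH' x : x \in `]a, b[ -> is_derive x 1 H (h x).
  by rewrite in_itv /= => /andP[ac cb]; apply: dH; rewrite !ltW.
have [c cab ->] := MVT_segment ab dH' dcH.
rewrite normrM (ger0_norm (_ : 0 <= b - a)) ?subr_ge0 //.
by apply: ler_wpM2r; rewrite ?subr_ge0 //; apply: hM; rewrite in_itv /= in cab.
Qed.

Lemma increment_eq H1 H2 h a b s t :
  (forall x, a <= x <= b -> is_derive x 1 H1 (h x)) ->
  (forall x, a <= x <= b -> is_derive x 1 H2 (h x)) ->
  a <= s <= b -> a <= t <= b ->
  H1 t - H1 s = H2 t - H2 s.
Proof.
wlog st : s t / s <= t.
  move=> W; have [|/ltW ts d1 d2 sab tab] := leP s t; first exact: W.
  by apply: oppr_inj; rewrite !opprB; exact: W.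
move=> d1 d2 /andP[as_ _] /andP[_ tb].
have d12 x : s <= x <= t -> is_derive x 1 (H1 - H2) (h x - h x).
  move=> /andP[sx xt]; have xab : a <= x <= b by rewrite (le_trans as_) ?(le_trans xt).
  by apply: is_deriveB; [exact: d1|exact: d2].
have := @increment_bound (H1 - H2) _ s t 0 st d12.
rewrite mul0r normr_le0 => /(_ _)/eqP K.
apply/eqP; rewrite -subr_eq0 -[X in _ == X](K _); last first.
  by move=> x _; rewrite subrr normr0.
by apply/eqP; rewrite !fctE; ring.
Qed.

Lemma primitive_half_line h a x : continuous h -> a < x ->
  is_derive x 1 (fun y : R => \int[mu]_(t in `[a, y]) h t)%R (h x).
Proof.
move=> ch ax; have xu : x < x + 1 by rewrite ltrDl.
have ih : mu.-integrable `[a, x + 1] (EFin \o h).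
  apply: continuous_compact_integrable; first exact: segment_compact.
  exact: continuous_subspaceT.
have [d1 d2] := continuous_FTC1_closed xu ih ax (ch x).
by split => //; rewrite -derive1E.
Qed.

(** The integral from [a] is known to be a primitive only to the right of [a]. A primitive on the
    whole line is glued from these integrals, normalised to vanish at 0. *)
Lemma primitive_exists h : continuous h ->
  exists H, forall x, is_derive x 1 H (h x).
Proof.
move=> ch; pose F a y := (\int[mu]_(t in `[a, y]) h t)%R.
have dF a x : a < x -> is_derive x 1 (F a) (h x) by exact: primitive_half_line.
have indep a b x : a < x -> b < x -> a < 0 -> b < 0 ->
    F a x - F a 0 = F b x - F b 0.
  move=> ax bx a0 b0; pose m := Num.min x 0.
  have am : a < m by rewrite lt_min ax.
  have bm : b < m by rewrite lt_min bx.
  apply: (@increment_eq _ _ h m (Num.max x 0)).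
  - by move=> y /andP[my _]; apply: dF; exact: lt_le_trans my.
  - by move=> y /andP[my _]; apply: dF; exact: lt_le_trans my.
  - by rewrite ge_min le_max lexx !orbT.
  - by rewrite ge_min le_max lexx.
(* The base point moves with [x] so as to lie below both [x] and 0; by [indep] the normalised value
   does not depend on it. *)
exists (fun x => F (- (`|x| + 1)) x - F (- (`|x| + 1)) 0) => x.
(* A single base point valid for every [y] at distance less than 1 from [x]. *)
pose a := - (`|x| + 2).
have ax : a < x by rewrite /a; have := ler_norm (- x); rewrite normrN; lra.
have a0 : a < 0 by rewrite /a; have := normr_ge0 x; lra.
apply: (@near_eq_is_derive _ _ _ (fun y => F a y - cst (F a 0) y)); last first.
  by rewrite -[h x]subr0; apply: is_deriveB; exact: dF.
apply/nbhs_ballP; exists 1 => //= y; rewrite -ball_normE /ball_ /= => yx.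
have := ler_norm (- y); rewrite normrN => ny; have := normr_ge0 y => y0.
have ay : a < y.
  by rewrite /a; have := ler_norm (x - y); have := ler_norm (- x); rewrite normrN; lra.
by apply: indep => //; lra.
Qed.

Definition primitive h : R -> R :=
  xget (fun=> 0) [set H | forall x, is_derive x 1 H (h x)].

Lemma primitiveP h : continuous h ->
  forall x, is_derive x 1 (primitive h) (h x).
Proof.
move=> ch; have [H HP] := primitive_exists ch.
by rewrite /primitive; case: xgetP => [G -> //|/(_ H)].
Qed.

(* The integral as the increment of a primitive; junk unless [h] is continuous. *)
Definition rint h a b := primitive h b - primitive h a.

Lemma rint_prim h H a b : (forall x, is_derive x 1 H (h x)) -> continuous h ->
  rint h a b = H b - H a.
Proof.
move=> dH ch; pose m := Num.min a b; pose M := Num.max a b.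
have am : m <= a <= M by rewrite ge_min le_max lexx.
have bm : m <= b <= M by rewrite ge_min le_max lexx !orbT.
by apply: (increment_eq _ _ am bm) => x _; [exact: primitiveP|exact: dH].
Qed.

Lemma rint_bound h a b (M : R) : continuous h -> a <= b ->
  (forall x, a <= x <= b -> `|h x| <= M) -> `|rint h a b| <= M * (b - a).
Proof.
by move=> ch ab; apply: increment_bound => // x _; exact: primitiveP.
Qed.

End RealPrimitive.

(** * Integrals of complex-valued functions of a real variable *)

Section ComplexIntegral.
Variable R : realType.
Local Notation C := (Cplx R).
Implicit Types (a b c x t : R) (h g H : R -> C) (z w k : C).

Lemma continuous_re : continuous (@re R).
Proof.
move=> z; have H : @re R x @[x --> z] --> @re R z; last exact: H.
apply/(@cvgrPdist_lt _ _ _ (nbhs z) (nbhs_filter z)) => e e0.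
apply/nbhs_CplxP; exists e => // w.
by rewrite modulusC => /(le_lt_trans (abs_re_le _)); rewrite reD reN.
Qed.

Lemma continuous_im : continuous (@im R).
Proof.
move=> z; have H : @im R x @[x --> z] --> @im R z; last exact: H.
apply/(@cvgrPdist_lt _ _ _ (nbhs z) (nbhs_filter z)) => e e0.
apply/nbhs_CplxP; exists e => // w.
by rewrite modulusC => /(le_lt_trans (abs_im_le _)); rewrite imD imN.
Qed.

Lemma continuous_mkC (T : topologicalType) (f g : T -> R) :
  continuous f -> continuous g -> continuous (fun s : T => mkC (f s) (g s)).
Proof.
move=> cf cg t A /nbhs_CplxP [d d0 dA].
have d20 : 0 < d / 2 by rewrite divr_gt0.
have /cvgrPdist_lt/(_ _ d20) := cf t; have /cvgrPdist_lt/(_ _ d20) := cg t.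
move=> H1 H2; near=> s; apply: dA; apply: le_lt_trans (modulus_le _) _.
rewrite !(reD, imD, reN, imN) /=.
rewrite (splitr d) ltrD // distrC; first by near: s.
by near: s.
Unshelve. all: by end_near. Qed.

Definition cint h a b : C := mkC (rint (@re R \o h) a b) (rint (@im R \o h) a b).

Lemma continuous_re_comp h : continuous h -> continuous (@re R \o h).
Proof. by move=> ch t; apply: continuous_comp; [exact: ch|exact: continuous_re]. Qed.

Lemma continuous_im_comp h : continuous h -> continuous (@im R \o h).
Proof. by move=> ch t; apply: continuous_comp; [exact: ch|exact: continuous_im]. Qed.

Lemma cint_chasles h a b c : cint h a b + cint h b c = cint h a c.
Proof.
apply: Cplx_ext; rewrite ?reD ?imD /cint /re /im /=.
  by rewrite /rint addrC addrA subrK.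
by rewrite /rint addrC addrA subrK.
Qed.

Lemma cint_prim h H a b : continuous h ->
  (forall x, is_derive x 1 (@re R \o H) (re (h x)) /\
             is_derive x 1 (@im R \o H) (im (h x))) ->
  cint h a b = H b - H a.
Proof.
move=> ch dH; apply: Cplx_ext; rewrite ?reD ?imD ?reN ?imN.
  apply: (@rint_prim _ _ (@re R \o H)); last exact: continuous_re_comp.
  by move=> x; have [] := dH x.
apply: (@rint_prim _ _ (@im R \o H)); last exact: continuous_im_comp.
by move=> x; have [] := dH x.
Qed.

Lemma cint_linear h g a b k l : continuous h -> continuous g ->
  cint (fun t => k * h t + l * g t) a b = k * cint h a b + l * cint g a b.
Proof.
move=> ch cg.
(* Complex coefficients mix real and imaginary parts, so linearity is read off from a complex
   primitive of the combination. *)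
pose H t := k * mkC (primitive (@re R \o h) t) (primitive (@im R \o h) t) +
            l * mkC (primitive (@re R \o g) t) (primitive (@im R \o g) t).
rewrite (@cint_prim _ H); first by rewrite /H; apply: Cplx_ext;
  rewrite !(reD, imD, reN, imN, reM, imM) /cint /rint /re /im /=; ring.
- move=> t; apply: cvgD; apply: cvgM; [exact: cvg_cst|exact: ch|exact: cvg_cst|exact: cg].
have p1 := primitiveP (continuous_re_comp ch).
have p2 := primitiveP (continuous_im_comp ch).
have p3 := primitiveP (continuous_re_comp cg).
have p4 := primitiveP (continuous_im_comp cg).
move=> x; split.
  have -> : @re R \o H = (fun t => (re k * primitive (@re R \o h) t - im k * primitive (@im R \o h) t)
     + (re l * primitive (@re R \o g) t - im l * primitive (@im R \o g) t)).
    by apply/funext => t; rewrite /= /H reD !reM.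
  rewrite reD !reM.
  by apply: is_deriveD; apply: is_deriveB; apply: is_deriveZ.
have -> : @im R \o H = (fun t => (re k * primitive (@im R \o h) t + im k * primitive (@re R \o h) t)
     + (re l * primitive (@im R \o g) t + im l * primitive (@re R \o g) t)).
  by apply/funext => t; rewrite /= /H imD !imM.
rewrite imD !imM.
by apply: is_deriveD; apply: is_deriveD; apply: is_deriveZ.
Qed.

(** Bounding real and imaginary parts separately costs the factor 2, which is harmless: only some
    absolute constant matters later. *)
Lemma cint_bound h a b (M : R) : continuous h -> a <= b ->
  (forall x, a <= x <= b -> modulus (h x) <= M) ->
  modulus (cint h a b) <= 2 * M * (b - a).
Proof.
move=> ch ab hM; apply: (le_trans (modulus_le _)).
rewrite -mulrA mulr2n mulrDl mul1r; apply: lerD.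
  apply: rint_bound => //; first exact: continuous_re_comp.
  by move=> x /hM; apply: le_trans; exact: abs_re_le.
apply: rint_bound => //; first exact: continuous_im_comp.
by move=> x /hM; apply: le_trans; exact: abs_im_le.
Qed.

End ComplexIntegral.

(** * Goursat's theorem on rectangles *)

Section Goursat.
Variable R : realType.
Local Notation C := (Cplx R).
Implicit Types (x y t l h : R) (g P : C -> C) (z w : C).

Definition hline g y := fun t : R => g (mkC t y).
Definition vline g x := fun t : R => g (mkC x t).

(** Continuity is asked along entire lines, not only along the sides of a rectangle, because
    [primitive] is controlled only for functions continuous on all of [R]. *)
Definition line_continuous g :=
  (forall y, continuous (hline g y)) /\ (forall x, continuous (vline g x)).

Local Notation I := (mkC 0 1 : C).

(** The contour integral over the boundary, counterclockwise; the factor [I] is the derivative of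
    the parametrisation of the vertical sides. *)
Definition rectint g x1 x2 y1 y2 : C :=
  cint (hline g y1) x1 x2 - cint (hline g y2) x1 x2 +
  I * (cint (vline g x2) y1 y2 - cint (vline g x1) y1 y2).

Lemma cint_hline_prim g P y x1 x2 : line_continuous g ->
  (forall s, has_derivative P s (g s)) ->
  cint (hline g y) x1 x2 = P (mkC x2 y) - P (mkC x1 y).
Proof.
move=> [cg _] dP; apply: (@cint_prim _ _ (hline P y)) => // x.
have E t : mkC t y = mkC 0 y + toC t * 1 by apply: Cplx_ext => /=; ring.
have [] := @has_derivative_line _ P (mkC 0 y) 1 x (g (mkC x y)).
  by rewrite -E; exact: dP.
rewrite mulr1; under [X in is_derive _ _ X _ -> _]eq_fun => t do rewrite -E.
move=> d1; under [X in is_derive _ _ X _ -> _]eq_fun => t do rewrite -E.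
by move=> d2; split.
Qed.

Lemma cint_vline_prim g P x y1 y2 : line_continuous g ->
  (forall s, has_derivative P s (g s)) ->
  I * cint (vline g x) y1 y2 = P (mkC x y2) - P (mkC x y1).
Proof.
move=> [_ cg] dP.
have E t : mkC x t = mkC x 0 + toC t * I by apply: Cplx_ext => /=; ring.
(* The zero multiple is added only to match the shape of [cint_linear], which moves [I] under the
   integral. *)
have -> : I * cint (vline g x) y1 y2 =
  cint (fun t => I * vline g x t + 0 * vline g x t) y1 y2.
  by rewrite cint_linear // mul0r addr0.
apply: (@cint_prim _ _ (vline P x)) => [t|t].
  by apply: cvgD; apply: cvgM; by [exact: cvg_cst|exact: cg].
have [] := @has_derivative_line _ P (mkC x 0) I t (g (mkC x t)).
  by rewrite -E; exact: dP.
rewrite mul0r addr0 [I * _]mulrC.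
under [X in is_derive _ _ X _ -> _]eq_fun => s do rewrite -E.
move=> d1; under [X in is_derive _ _ X _ -> _]eq_fun => s do rewrite -E.
by move=> d2; split.
Qed.

Lemma rectint_prim g P x1 x2 y1 y2 : line_continuous g ->
  (forall s, has_derivative P s (g s)) -> rectint g x1 x2 y1 y2 = 0.
Proof.
move=> cg dP; rewrite /rectint mulrBr !(cint_vline_prim _ _ _ cg dP).
by rewrite !(cint_hline_prim _ _ _ cg dP); ring.
Qed.

Lemma line_continuous_affine a b : line_continuous (fun s : C => a + b * s).
Proof.
split=> y t; (apply: cvgD; first exact: cvg_cst); (apply: cvgM; first exact: cvg_cst).
  by apply: (@continuous_mkC _ R (fun s => s) (fun=> y)) => s; [exact: cvg_id|exact: cvg_cst].
by apply: (@continuous_mkC _ R (fun=> y) (fun s => s)) => s; [exact: cvg_cst|exact: cvg_id].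
Qed.

(** An affine function has a quadratic primitive. Hence the first-order approximation of a function
    can be subtracted without changing its integral. *)
Lemma rectint_affine a b x1 x2 y1 y2 :
  rectint (fun s => a + b * s) x1 x2 y1 y2 = 0.
Proof.
apply: (@rectint_prim _ (fun s => a * s + b / 2 * (s * s))).
  exact: line_continuous_affine.
move=> s; apply/is_derive_CplxP.
have -> : a + b * s = a *: (1 : C) + (b / 2) *: (s *: (1 : C) + s *: (1 : C)).
  by rewrite !scale_one /GRing.scale /=; field.
by apply: is_deriveD; apply: is_deriveZ.
Qed.

Lemma rectint_sub g1 g2 x1 x2 y1 y2 :
  line_continuous g1 -> line_continuous g2 ->
  rectint (fun s => g1 s - g2 s) x1 x2 y1 y2 =
  rectint g1 x1 x2 y1 y2 - rectint g2 x1 x2 y1 y2.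
Proof.
move=> [h1 v1] [h2 v2].
have K (f1 f2 : R -> C) a b : continuous f1 -> continuous f2 ->
    cint (fun t => f1 t - f2 t) a b = cint f1 a b - cint f2 a b.
  move=> c1 c2; rewrite -[cint f1 a b]mul1r -mulN1r -cint_linear //.
  by congr cint; apply/funext => t; rewrite mul1r mulN1r.
by rewrite /rectint /hline /vline !K //; [ring|exact: v1|exact: v2|
  exact: v1|exact: v2|exact: h1|exact: h2|exact: h1|exact: h2].
Qed.

Lemma rectint_splitx g x1 m x2 y1 y2 :
  rectint g x1 x2 y1 y2 = rectint g x1 m y1 y2 + rectint g m x2 y1 y2.
Proof. by rewrite /rectint -!(cint_chasles _ x1 m x2); ring. Qed.

Lemma rectint_splity g x1 x2 y1 m y2 :
  rectint g x1 x2 y1 y2 = rectint g x1 x2 y1 m + rectint g x1 x2 m y2.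
Proof. by rewrite /rectint -!(cint_chasles _ y1 m y2); ring. Qed.

Lemma rectint_bound g x1 x2 y1 y2 (M : R) :
  line_continuous g -> x1 <= x2 -> y1 <= y2 ->
  (forall x y, x1 <= x <= x2 -> y1 <= y <= y2 -> modulus (g (mkC x y)) <= M) ->
  modulus (rectint g x1 x2 y1 y2) <= 4 * M * ((x2 - x1) + (y2 - y1)).
Proof.
move=> [ch cv] xx yy gM.
have H y : y1 <= y <= y2 -> modulus (cint (hline g y) x1 x2) <= 2 * M * (x2 - x1).
  by move=> yin; apply: cint_bound => // x xin; exact: gM.
have V x : x1 <= x <= x2 -> modulus (cint (vline g x) y1 y2) <= 2 * M * (y2 - y1).
  by move=> xin; apply: cint_bound => // y yin; exact: gM.
have h1 := H y1; have h2 := H y2; have v1 := V x1; have v2 := V x2.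
rewrite !lexx ?xx ?yy in h1 h2 v1 v2.
have {}h1 := h1 isT; have {}h2 := h2 isT; have {}v1 := v1 isT; have {}v2 := v2 isT.
apply: (le_trans (modulusD _ _)); rewrite modulusM modulus_i mul1r.
have := modulusB (cint (hline g y1) x1 x2) (cint (hline g y2) x1 x2).
have := modulusB (cint (vline g x2) y1 y2) (cint (vline g x1) y1 y2).
lra.
Qed.

(** The integral is the sum of those over the four quarters, as the inner sides cancel; one quarter
    therefore carries at least a fourth of the modulus. *)
Let quarter_step g l h (p : R * R) : 0 <= l -> 0 <= h ->
  exists q : R * R, [/\ p.1 <= q.1 <= p.1 + l / 2, p.2 <= q.2 <= p.2 + h / 2 &
    modulus (rectint g p.1 (p.1 + l) p.2 (p.2 + h)) <=
    4 * modulus (rectint g q.1 (q.1 + l / 2) q.2 (q.2 + h / 2))].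
Proof.
case: p => x y /= l0 h0.
rewrite (rectint_splitx _ x (x + l / 2)) (rectint_splity _ x _ y (y + h / 2)).
rewrite (rectint_splity _ (x + l / 2) _ y (y + h / 2)).
have -> : x + l = x + l / 2 + l / 2 by field.
have -> : y + h = y + h / 2 + h / 2 by field.
have l2 : 0 <= l / 2 by rewrite divr_ge0.
have h2 : 0 <= h / 2 by rewrite divr_ge0.
set A := rectint _ x _ y _; set B := rectint _ x _ (y + h / 2) _.
set D := rectint _ (x + l / 2) _ y _; set E := rectint _ (x + l / 2) _ (y + h / 2) _.
have big : modulus (A + B + (D + E)) <= modulus A + modulus B + (modulus D + modulus E).
  by apply: (le_trans (modulusD _ _)); apply: lerD; exact: modulusD.
have [H|] := leP (modulus (A + B + (D + E))) (4 * modulus A).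
  by exists (x, y); split => //=; rewrite lexx lerDl.
move=> HA; have [H|] := leP (modulus (A + B + (D + E))) (4 * modulus B).
  by exists (x, y + h / 2); split => //=; rewrite ?lexx lerDl ?l2 ?h2.
move=> HB; have [H|] := leP (modulus (A + B + (D + E))) (4 * modulus D).
  by exists (x + l / 2, y); split => //=; rewrite ?lexx lerDl ?l2 ?h2.
(* If the first three quarters each fall short of a fourth, the triangle inequality leaves the last
   one. *)
move=> HD; exists (x + l / 2, y + h / 2); split => /=; try by rewrite lexx lerDl ?l2 ?h2.
lra.
Qed.

(** The left ends increase and the right ends decrease, because each length is half the previous
    one; the supremum of the left ends lies in all intervals. *)
Lemma nested_point (u : nat -> R) l : 0 <= l ->
  (forall n, u n <= u n.+1 <= u n + l / 2 ^+ n.+1) ->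
  exists c, forall n, u n <= c <= u n + l / 2 ^+ n.
Proof.
move=> l0 Hu.
have up n k : u n <= u (n + k)%N.
  elim: k => [|k IH]; first by rewrite addn0.
  by rewrite addnS (le_trans IH) //; have /andP[] := Hu (n + k)%N.
have dn n k : u (n + k)%N + l / 2 ^+ (n + k) <= u n + l / 2 ^+ n.
  elim: k => [|k IH]; first by rewrite addn0.
  apply: le_trans IH; rewrite addnS; have /andP[_] := Hu (n + k)%N.
  have -> : l / 2 ^+ (n + k) = l / 2 ^+ (n + k).+1 + l / 2 ^+ (n + k).+1.
    by rewrite exprS; field; rewrite expf_neq0.
  by rewrite addrA => H; rewrite lerD2r.
have cross m n : u m <= u n + l / 2 ^+ n.
  have p0 k : 0 <= l / 2 ^+ k by rewrite divr_ge0 // exprn_ge0.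
  have [mn|/ltnW nm] := leqP m n.
    by rewrite -(subnKC mn) (le_trans (up m (n - m)%N)) // lerDl.
  by have := dn n (m - n)%N; rewrite subnKC //; apply: le_trans; rewrite lerDl.
exists (sup (range u)) => n; apply/andP; split.
  apply: ub_le_sup; last by exists n.
  by exists (u 0%N + l / 2 ^+ 0) => _ [m _ <-].
by apply: ge_sup; [exists (u 0%N), 0%N|move=> _ [m _ <-]].
Qed.

(** Repeated quartering leads to a point [mkC cx cy] and loses at most a factor [4 ^+ n] after [n]
    steps. Near that point [g] is affine up to an error small relative to the size of the rectangle;
    both this size and the perimeter are of order [2 ^- n], which compensates the loss. *)
Theorem Goursat_rectangle g x0 y0 l h : 0 <= l -> 0 <= h -> line_continuous g ->
  (forall x y, x0 <= x <= x0 + l -> y0 <= y <= y0 + h ->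
     exists b, has_derivative g (mkC x y) b) ->
  rectint g x0 (x0 + l) y0 (y0 + h) = 0.
Proof.
move=> l0 h0 cg dg.
have p2 n : 0 < (2 : R) ^+ n by rewrite exprn_gt0.
pose Q n (p : R * R) := rectint g p.1 (p.1 + l / 2 ^+ n) p.2 (p.2 + h / 2 ^+ n).
have step (np : nat * (R * R)) : exists q : R * R,
    [/\ np.2.1 <= q.1 <= np.2.1 + l / 2 ^+ np.1.+1,
        np.2.2 <= q.2 <= np.2.2 + h / 2 ^+ np.1.+1 &
        modulus (Q np.1 np.2) <= 4 * modulus (Q np.1.+1 q)].
  have E (a : R) n : a / 2 ^+ n.+1 = a / 2 ^+ n / 2.
    by rewrite exprSr invfM mulrA.
  by rewrite /Q !E; apply: quarter_step; rewrite divr_ge0 // ltW.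
have [F FP] := choice step.
pose u := fix u n := if n is m.+1 then F (m, u m) else (x0, y0).
have uP n := FP (n, u n).
have [|cx cxP] := @nested_point (fun n => (u n).1) l l0.
  by move=> n; have [] := uP n.
have [|cy cyP] := @nested_point (fun n => (u n).2) h h0.
  by move=> n; have [] := uP n.
have grow n : modulus (Q 0%N (u 0%N)) <= 4 ^+ n * modulus (Q n (u n)).
  elim: n => [|n IH]; first by rewrite mul1r.
  apply: (le_trans IH); rewrite exprSr -mulrA ler_wpM2l ?exprn_ge0 //.
  by have [] := uP n.
have [b db] : exists b, has_derivative g (mkC cx cy) b.
  by apply: dg; [have := cxP 0%N|have := cyP 0%N]; rewrite /= expr0 divr1.
have -> : rectint g x0 (x0 + l) y0 (y0 + h) = Q 0%N (u 0%N).
  by rewrite /Q /= expr0 !divr1.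
apply: modulus0_eq; apply/eqP; rewrite eq_le modulus_ge0 andbT.
apply/ler_addgt0Pr => e e0; rewrite add0r.
(* The first summand is what remains after [4 ^+ n] cancels in the final estimate; adding 1 keeps
   [K] positive for a degenerate rectangle. *)
pose K := 4 * (l + h) * (l + h) + 1.
have K0 : 0 < K by rewrite /K ltr_wpDl // !mulr_ge0 // addr_ge0.
have [d d0 dP] := db _ (divr_gt0 e0 K0).
have [n nP] : exists n, (l + h) / 2 ^+ n < d.
  have [n] : exists n : nat, (l + h) / d < n%:R.
    by exists (Num.truncn ((l + h) / d)).+1; rewrite truncnS_gt // num_real.
  exists n; rewrite ltr_pdivrMr // mulrC -ltr_pdivrMr //; apply: lt_trans p _.
  by rewrite -natrX ltr_nat ltn_expl.
apply: (le_trans (grow n)).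
pose s := (l + h) / 2 ^+ n.
(* The first-order approximation of [g] at the limit point, whose integral vanishes. *)
pose aff := fun w => (g (mkC cx cy) - b * mkC cx cy) + b * w.
have caff : line_continuous aff by exact: line_continuous_affine.
have crho : line_continuous (fun w => g w - aff w).
  split=> [y t|x t].
    by apply: cvgB; [exact: cg.1|exact: caff.1].
  by apply: cvgB; [exact: cg.2|exact: caff.2].
have QE : Q n (u n) = rectint (fun w => g w - aff w) (u n).1 ((u n).1 + l / 2 ^+ n)
   (u n).2 ((u n).2 + h / 2 ^+ n).
  by rewrite rectint_sub // rectint_affine subr0.
have Qb : modulus (Q n (u n)) <= 4 * (e / K * s) * s.
  have -> : 4 * (e / K * s) * s = 4 * (e / K * s) *
     ((u n).1 + l / 2 ^+ n - (u n).1 + ((u n).2 + h / 2 ^+ n - (u n).2)).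
    by rewrite /s; ring.
  rewrite QE; apply: rectint_bound => //; rewrite ?lerDl ?divr_ge0 ?(ltW (p2 _)) //.
  move=> x y xin yin.
  have wd : modulus (mkC x y - mkC cx cy) <= s.
    apply: (le_trans (modulus_le _)); rewrite !(reD, imD, reN, imN) /=.
    rewrite /s mulrDl; apply: lerD; rewrite ler_norml.
      by have := cxP n; move: xin; move: (l / 2 ^+ n) => L /andP[? ?] /andP[? ?];
      apply/andP; split; lra.
    by have := cyP n; move: yin; move: (h / 2 ^+ n) => L /andP[? ?] /andP[? ?];
      apply/andP; split; lra.
  have -> : g (mkC x y) - aff (mkC x y) = g (mkC x y) - g (mkC cx cy) -
     b * (mkC x y - mkC cx cy) by rewrite /aff; ring.
  apply: (le_trans (dP _ (le_lt_trans wd nP))).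
  by rewrite ler_wpM2l // ltW // divr_gt0.
apply: (@le_trans _ _ (4 ^+ n * (4 * (e / K * s) * s))).
  by rewrite ler_wpM2l // exprn_ge0.
have -> : 4 ^+ n * (4 * (e / K * s) * s) = e * (4 * (l + h) * (l + h) / K).
  rewrite /s (_ : 4 = 2 * 2 :> R); last by ring.
  rewrite exprMn; field; rewrite !lt0r_neq0 //.
by rewrite ger_pMr // ler_pdivrMr // mul1r /K lerDl.
Qed.

End Goursat.

(** * The complex exponential and the Cauchy estimate *)

Section ComplexExponential.
Variable R : realType.
Local Notation C := (Cplx R).
Implicit Types (x y t : R) (f g : C -> C) (z w l m : C).

Lemma is_derive_real_bound (f : R -> R) (x l : R) : is_derive x 1 f l ->
  forall e, 0 < e -> exists2 d : R, 0 < d & forall y, `|y - x| < d ->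
     `|f y - f x - l * (y - x)| <= e * `|y - x|.
Proof.
move=> [df dl] e e0.
have /cvgrPdist_le/(_ _ e0) : (fun h : R => h^-1 *: (f (h *: 1 + x) - f x)) @ (0 : R)^' --> l.
  by rewrite -dl; exact: df.
rewrite near_withinE => /nbhs_ballP [d /= d0 dP]; exists d => // y yd.
have [->|yx] := eqVneq y x; first by rewrite !subrr mulr0 subrr normr0 mulr0.
have yx' : y - x != 0 by rewrite subr_eq0.
have := dP (y - x); rewrite -ball_normE /ball_ /= sub0r normrN => /(_ yd yx').
rewrite scale_one subrK => {}dP.
have -> : f y - f x - l * (y - x) = - ((l - (y - x)^-1 * (f y - f x)) * (y - x)).
  by field.
by rewrite normrN normrM ler_wpM2r.
Qed.

Lemma has_derivativeD f g z l m : has_derivative f z l -> has_derivative g z m ->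
  has_derivative (fun w => f w + g w) z (l + m).
Proof.
move=> /is_derive_CplxP Hf /is_derive_CplxP Hg; exact/is_derive_CplxP.
Qed.

Lemma has_derivativeB f g z l m : has_derivative f z l -> has_derivative g z m ->
  has_derivative (fun w => f w - g w) z (l - m).
Proof.
move=> /is_derive_CplxP Hf /is_derive_CplxP Hg; exact/is_derive_CplxP.
Qed.

Lemma has_derivativeM f g z l m : has_derivative f z l -> has_derivative g z m ->
  has_derivative (fun w => f w * g w) z (l * g z + f z * m).
Proof.
move=> /is_derive_CplxP Hf /is_derive_CplxP Hg; apply/is_derive_CplxP.
by rewrite addrC [l * _]mulrC; exact: (is_deriveM Hf Hg).
Qed.

Lemma has_derivative_cst z m : has_derivative (fun=> m) z 0.
Proof. exact/is_derive_CplxP. Qed.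

Lemma has_derivative_id z : has_derivative id z 1.
Proof. exact/is_derive_CplxP. Qed.

Lemma has_derivativeZ f z l m : has_derivative f z l ->
  has_derivative (fun w => m * f w) z (m * l).
Proof.
move=> Hf; rewrite -[m * l]add0r -(mul0r (f z)).
by apply: has_derivativeM => //; exact: has_derivative_cst.
Qed.

Lemma has_derivative_shift f z l m : has_derivative f (z + m) l ->
  has_derivative (fun w => f (w + m)) z l.
Proof.
move=> Hf; rewrite -[l]mulr1; apply: (has_derivative_comp (g := fun w => w + m)) Hf.
by rewrite -[1]addr0; apply: has_derivativeD;
  [exact: has_derivative_id|exact: has_derivative_cst].
Qed.

Lemma has_derivative_near f g z l :
  (exists2 d : R, 0 < d & forall w, modulus (w - z) < d -> f w = g w) ->
  has_derivative f z l -> has_derivative g z l.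
Proof.
move=> [d d0 fg] Hf e /Hf[d' d'0 H]; exists (Num.min d d').
  by rewrite lt_min d0.
move=> w; rewrite lt_min => /andP[wd wd']; rewrite -!fg //; first exact: H.
by rewrite subrr modulus0.
Qed.

Lemma cexpD z w : cexp (z + w) = cexp z * cexp w.
Proof.
rewrite /cexp; apply: Cplx_ext; rewrite !(reM, imM, reD, imD) /= expRD ?cosD ?sinD; ring.
Qed.

Lemma cexp0 : cexp (0 : C) = 1.
Proof. by rewrite /cexp /= expR0 cos0 sin0; apply: Cplx_ext; rewrite !(reM, imM) /=; ring. Qed.

Lemma modulus_cexp z : modulus (cexp z) = expR (re z).
Proof.
rewrite /cexp modulusM modulus_toC gtr0_norm ?expR_gt0 // modulusE /=.
by rewrite cos2Dsin2 sqrtr1 mulr1.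
Qed.

Lemma cexp_neq0 z : cexp z != 0.
Proof. by rewrite -modulus_gt0 modulus_cexp expR_gt0. Qed.

Lemma cexpN z : cexp (- z) = (cexp z)^-1.
Proof. by apply: (mulIf (cexp_neq0 z)); rewrite mulVf ?cexp_neq0 // -cexpD addNr cexp0. Qed.

Lemma cexp_periodic x : cexp (mkC x (pi *+ 2)) = cexp (mkC x 0).
Proof. by rewrite /cexp /= cos2pi sin2pi cos0 sin0. Qed.

(** The remainder splits into three terms, each controlled by the real derivatives at 0 of the
    exponential, the sine and the cosine. *)
Lemma has_derivative_cexp0 : has_derivative (@cexp R) 0 1.
Proof.
move=> e e0.
(* The three terms contribute at most [e1], [2 * e1] and [3 * e1] times [modulus w], so that 10
   leaves some slack. The last bound uses [modulus w < e1], hence [e1] also enters the radius. *)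
pose e1 := Num.min 1 (e / 10).
have e10 : 0 < e1 by rewrite lt_min ltr01 divr_gt0.
have e11 : e1 <= 1 by rewrite ge_min lexx.
have e1e : e1 <= e / 10 by rewrite ge_min lexx orbT.
clearbody e1.
have [d1 d10 P1] := is_derive_real_bound (is_derive_expR (0 : R)) e10.
have [d2 d20 P2] := is_derive_real_bound (is_derive_sin (0 : R)) e10.
have [d3 d30 P3] := is_derive_real_bound (is_derive_cos (0 : R)) e10.
rewrite expR0 cos0 sin0 oppr0 in P1 P2 P3.
exists (Num.min e1 (Num.min d1 (Num.min d2 d3))); first by rewrite !lt_min e10 d10 d20.
move=> w; rewrite subr0 !lt_min mul1r => /and4P[we wd1 wd2 wd3].
have xw := abs_re_le w; have yw := abs_im_le w.
set x := re w in xw *; set y := im w in yw *; set r := modulus w in we xw yw wd1 wd2 wd3 *.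
have := P1 x; have := P2 y; have := P3 y; rewrite !(oppr0, addr0, mul1r, mul0r).
move=> /(_ (le_lt_trans yw wd3)) H3 /(_ (le_lt_trans yw wd2)) H2 /(_ (le_lt_trans xw wd1)) H1.
have r0 : 0 <= r by exact: modulus_ge0.
have {}H1 : `|expR x - 1 - x| <= e1 * r by rewrite (le_trans H1) // ler_wpM2l // ltW.
have {}H2 : `|sin y - y| <= e1 * r by rewrite (le_trans H2) // ler_wpM2l // ltW.
have {}H3 : `|cos y - 1| <= e1 * r by rewrite (le_trans H3) // ler_wpM2l // ltW.
pose E : C := mkC (cos y) (sin y).
have mE : modulus E = 1 by rewrite modulusE /= cos2Dsin2 sqrtr1.
have -> : cexp w - cexp 0 - w = toC (expR x - 1 - x) * E +
     mkC (cos y - 1) (sin y - y) + toC x * mkC (cos y - 1) (sin y).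
  rewrite cexp0 /cexp -/x -/y /E; apply: Cplx_ext;
    rewrite !(reD, imD, reN, imN, reM, imM) /= -?/x -?/y; ring.
have B2 : modulus (mkC (cos y - 1) (sin y - y)) <= 2 * (e1 * r).
  by apply: (le_trans (modulus_le _)) => /=; lra.
have sy : `|sin y| <= 2 * r.
  have : e1 * r <= 1 * r by rewrite ler_wpM2r.
  have := ler_normD (sin y - y) y; rewrite subrK; lra.
have B3 : modulus (mkC (cos y - 1) (sin y)) <= 3 * r.
  have h1 : e1 * r <= 1 * r by rewrite ler_wpM2r.
  by apply: (le_trans (modulus_le _)) => /=; lra.
apply: (le_trans (modulusD _ _)); rewrite modulusM modulus_toC.
have {}B3 : `|x| * modulus (mkC (cos y - 1) (sin y)) <= e1 * (3 * r).
  by apply: ler_pM => //; [exact: modulus_ge0|rewrite (le_trans xw) // ltW].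
have := modulusD (toC (expR x - 1 - x) * E) (mkC (cos y - 1) (sin y - y)).
rewrite modulusM mE mulr1 modulus_toC.
have : e1 * r <= e / 10 * r by rewrite ler_wpM2r.
have : 0 <= e * r by rewrite mulr_ge0 // ltW.
lra.
Qed.

Lemma has_derivative_cexp z : has_derivative (@cexp R) z (cexp z).
Proof.
have H : has_derivative (fun w => cexp z * cexp (w + - z)) z (cexp z * 1).
  apply: has_derivativeZ; apply: has_derivative_shift.
  by rewrite subrr; exact: has_derivative_cexp0.
rewrite mulr1 in H; apply: has_derivative_near H; exists 1 => // w _.
by rewrite -cexpD addrC subrK.
Qed.

Lemma has_derivative_continuous_at f z l : has_derivative f z l -> {for z, continuous f}.
Proof.
move=> /has_derivative_continuous H.
have K : f x @[x --> z] --> f z; last exact: K.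
move=> A /nbhs_CplxP [e e0 eA]; have [d d0 dP] := H _ e0.
by apply/nbhs_CplxP; exists d => // w /dP /eA.
Qed.

End ComplexExponential.

(** * Cauchy's estimate for the derivative *)

Section CauchyEstimate.
Variable R : realType.
Local Notation C := (Cplx R).
Implicit Types (x y t r : R) (f g q : C -> C) (z w a l : C).

(** [2 * pi] times the mean of the difference quotient of [q] at [a] over the circle of radius
    [expR x], that is, Cauchy's integral for the derivative in the coordinate [s] with
    [w = a + cexp s]. *)
Definition circle_mean q a x : C :=
  cint (fun t => (q (a + cexp (mkC x t)) - q a) * cexp (- mkC x t)) 0 (pi *+ 2).

Variables (q : C -> C) (a : C) (rho : R).
Hypothesis dq : forall w, modulus (w - a) < rho -> exists l, has_derivative q w l.

Lemma re_le_disk x s : expR x < rho -> re s <= x -> modulus (a + cexp s - a) < rho.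
Proof. by move=> xr sx; rewrite addrC addKr modulus_cexp (le_lt_trans _ xr) // ler_expR. Qed.

(* Truncating the real part makes the integrand continuous along every line,
   as the integration lemmas require; it is holomorphic only below the cut. *)
Let integrand x s : C :=
  (q (a + cexp (mkC (Num.min (re s) x) (im s))) - q a) * cexp (- s).

Lemma integrand_line_continuous x : expR x < rho -> line_continuous (integrand x).
Proof.
move=> xr.
have cE (u v : R -> R) : continuous u -> continuous v ->
   continuous (fun t => integrand x (mkC (u t) (v t))).
  move=> cu cv t.
  have cm : continuous (fun s => mkC (Num.min (u s) x) (v s)).
    apply: continuous_mkC => // s.
    by apply: (@continuous_min _ _ u (fun=> x)); [exact: cu|exact: cvg_cst].
  apply: cvgM.
    apply: cvgB; last exact: cvg_cst.
    apply: (@continuous_comp _ _ _ (fun s => mkC (Num.min (u s) x) (v s))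
      (fun w => q (a + cexp w))); first exact: cm.
    have [l dl] : exists l, has_derivative q (a + cexp (mkC (Num.min (u t) x) (v t))) l.
      by apply: dq; apply: re_le_disk xr _; rewrite /= ge_min lexx orbT.
    apply: (@has_derivative_continuous_at _ _ _ (l * cexp (mkC (Num.min (u t) x) (v t)))).
    apply: (has_derivative_comp (g := fun w => a + cexp w)) dl.
    rewrite -[cexp _]add0r; apply: has_derivativeD; last exact: has_derivative_cexp.
    exact: has_derivative_cst.
  apply: (@continuous_comp _ _ _ (fun s => - mkC (u s) (v s)) (@cexp R)).
    by apply: cvgN; exact: continuous_mkC.
  exact: has_derivative_continuous_at (has_derivative_cexp _).
split=> y.
  by apply: (cE (fun s => s) (fun=> y)) => s; [exact: cvg_id|exact: cvg_cst].
by apply: (cE (fun=> y) (fun s => s)) => s; [exact: cvg_cst|exact: cvg_id].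
Qed.

Lemma vline_integrand x y : y <= x ->
  vline (integrand x) y = fun t => (q (a + cexp (mkC y t)) - q a) * cexp (- mkC y t).
Proof. by move=> yx; apply/funext => t; rewrite /vline /integrand /= min_l. Qed.

(** In Goursat's theorem on the rectangle with sides [[x1, x2]] and [[0, 2 pi]], the horizontal
    integrals cancel by periodicity and the vertical ones are the two means. *)
Lemma circle_mean_cst x1 x2 : x1 <= x2 -> expR x2 < rho ->
  circle_mean q a x1 = circle_mean q a x2.
Proof.
move=> x12 x2r.
(* The cut is placed strictly to the right of [x2], so that the truncated integrand equals the
   holomorphic one near every point of the closed rectangle. The witness is the logarithm of the
   midpoint of [expR x2] and [rho]. *)
have [x x2x xr] : exists2 x, x2 < x & expR x < rho.
  have rho0 : 0 < rho by apply: lt_trans x2r; exact: expR_gt0.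
  exists (ln ((expR x2 + rho) / 2)).
    rewrite -ltr_expR lnK ?posrE; first lra.
    by have := expR_gt0 x2; lra.
  rewrite lnK ?posrE; first lra.
  by have := expR_gt0 x2; lra.
have lc := integrand_line_continuous xr.
have := @Goursat_rectangle _ (integrand x) x1 0 (x2 - x1) (pi *+ 2).
rewrite subr_ge0 x12 mulrn_wge0 ?pi_ge0 // => /(_ isT isT lc).
have -> : x1 + (x2 - x1) = x2 by ring.
rewrite add0r /rectint => H.
have hh : hline (integrand x) 0 = hline (integrand x) (pi *+ 2).
  by apply/funext => t; rewrite /hline /integrand /= cexp_periodic !cexpN cexp_periodic.
rewrite hh subrr add0r in H.
rewrite /circle_mean -!(vline_integrand (x := x)) ?(le_trans x12) ?ltW //.
apply/esym/eqP; rewrite -subr_eq0.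
have I0 : (mkC 0 1 : C) != 0 by rewrite -modulus_gt0 modulus_i.
rewrite -(mulrI_eq0 _ (mulfI I0)); apply/eqP; apply: H => s t /andP[_ sx] _.
have {}sx : s < x by exact: le_lt_trans x2x.
have [l dl] : exists l, has_derivative q (a + cexp (mkC s t)) l.
  by apply: dq; apply: re_le_disk xr _; rewrite /= ltW.
exists (l * cexp (mkC s t) * cexp (- mkC s t) +
   (q (a + cexp (mkC s t)) - q a) * (- cexp (- mkC s t))).
apply: (@has_derivative_near _ (fun w => (q (a + cexp w) - q a) * cexp (- w))).
  exists (x - s); first by rewrite subr_gt0.
  move=> w /(le_lt_trans (abs_re_le _)) ws; rewrite /integrand min_l ?mkC_reim //.
  by move: ws; rewrite reD reN /= => /(le_lt_trans (ler_norm _)); lra.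
apply: has_derivativeM.
  rewrite -[X in has_derivative _ _ X]subr0; apply: has_derivativeB; last exact: has_derivative_cst.
  apply: (has_derivative_comp (g := fun w => a + cexp w)) dl.
  rewrite -[cexp _]add0r; apply: has_derivativeD; last exact: has_derivative_cexp.
  exact: has_derivative_cst.
rewrite -mulrN1; apply: (has_derivative_comp (g := fun w => - w)) (has_derivative_cexp _).
rewrite -[-1]sub0r; apply: (@has_derivative_near _ (fun w => 0 - w)).
  by exists 1 => // w _; rewrite sub0r.
by apply: has_derivativeB; [exact: has_derivative_cst|exact: has_derivative_id].
Qed.

Lemma circle_continuous x : expR x < rho ->
  continuous (fun t => (q (a + cexp (mkC x t)) - q a) * cexp (- mkC x t)).
Proof.
move=> xr; rewrite -(vline_integrand (lexx x)).
by have [_] := integrand_line_continuous xr; exact.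
Qed.

Lemma cint_cst (l : C) x y : cint (fun=> l) x y = l * toC (y - x).
Proof.
rewrite (@cint_prim _ _ (fun t => l * toC t)); first by rewrite toCD toCN; ring.
  by move=> t; exact: cvg_cst.
move=> t; split.
  have -> : @re R \o (fun t => l * toC t) = fun t => re l * t.
    by apply/funext => s; rewrite /= reM /=; ring.
  by rewrite -[X in is_derive _ _ _ X]mulr1; apply: is_deriveZ.
have -> : @im R \o (fun t => l * toC t) = fun t => im l * t.
  by apply/funext => s; rewrite /= imM /=; ring.
by rewrite -[X in is_derive _ _ _ X]mulr1; apply: is_deriveZ.
Qed.

(** The mean over the circle of radius [r] is bounded through [M]; it equals the mean over a tiny
    circle, which is close to [2 * pi * l]. The factor 2 is that of [cint_bound]. *)
Theorem Cauchy_estimate l r (M : R) : has_derivative q a l -> 0 < r < rho ->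
  (forall w, modulus (w - a) < rho -> modulus (q w - q a) <= M) ->
  modulus l <= 2 * M / r.
Proof.
move=> dl /andP[r0 rr] qM.
have pi0 : 0 < pi *+ 2 :> R by rewrite pmulrn_lgt0 // pi_gt0.
have xr : expR (ln r) = r by rewrite lnK.
have rho0 : 0 < rho by exact: lt_trans rr.
apply/ler_addgt0Pr => e e0.
have e20 : 0 < e / 2 by rewrite divr_gt0.
have [d d0 dP] := dl _ e20.
(* The logarithm of a radius at most [r] and strictly below [d], where the difference quotient is
   within [e / 2] of [l]. *)
pose x0 := Num.min (ln r) (ln (d / 2)).
have x0r : expR x0 < rho by rewrite (le_lt_trans _ rr) // -[X in _ <= X]xr ler_expR ge_min lexx.
have x0d : expR x0 < d.
  have : expR x0 <= d / 2 by rewrite -[X in _ <= X]lnK ?posrE ?divr_gt0 // ler_expR ge_min lexx orbT.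
  by lra.
have B1 : modulus (circle_mean q a x0) <= 2 * (M / r) * (pi *+ 2).
  rewrite (@circle_mean_cst x0 (ln r)) ?xr //; last by rewrite ge_min lexx.
  rewrite -[X in _ <= _ * X]subr0; apply: cint_bound; rewrite ?ltW //.
    by apply: circle_continuous; rewrite xr.
  move=> t _; rewrite modulusM modulus_cexp reN /= expRN xr.
  apply: ler_wpM2r; first by rewrite invr_ge0 ltW.
  by apply: qM; apply: re_le_disk => //; rewrite xr.
have B2 : modulus (circle_mean q a x0 - l * toC (pi *+ 2)) <= 2 * (e / 2) * (pi *+ 2).
  have c1 : continuous (fun _ : R => l) by move=> t; exact: cvg_cst.
  have -> : circle_mean q a x0 - l * toC (pi *+ 2) =
    cint (fun t => 1 * ((q (a + cexp (mkC x0 t)) - q a) * cexp (- mkC x0 t)) + -1 * l)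
         0 (pi *+ 2).
    by rewrite (cint_linear _ _ _ _ (circle_continuous x0r) c1) cint_cst subr0 mul1r mulN1r.
  rewrite -[X in _ <= _ * X]subr0; apply: cint_bound; last 2 first.
  - exact: ltW.
  - move=> t _; rewrite mul1r mulN1r cexpN.
    set w := cexp _; have w0 : w != 0 by exact: cexp_neq0.
    have mw : modulus w = expR x0 by rewrite modulus_cexp.
    have := dP (a + w); rewrite (addrC a) addrK mw => /(_ x0d) H.
    have -> : (q (w + a) - q a) / w - l = (q (w + a) - q a - l * w) / w by field.
    by rewrite modulusM modulusV mw ler_pdivrMr ?expR_gt0.
  move=> t; apply: cvgD; last exact: cvg_cst.
  by apply: cvgM; [exact: cvg_cst|exact: circle_continuous].
have : modulus (l * toC (pi *+ 2)) <= modulus (circle_mean q a x0) +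
    modulus (circle_mean q a x0 - l * toC (pi *+ 2)).
  rewrite -[X in modulus X <= _](subKr (circle_mean q a x0)); exact: modulusB.
rewrite modulusM modulus_toC gtr0_norm // => H.
rewrite -(ler_pM2r pi0); apply: (le_trans H).
apply: (le_trans (lerD B1 B2)); rewrite -mulrDl ler_pM2r //.
by rewrite -mulrA lerD2l; lra.
Qed.

End CauchyEstimate.

(** * Derivatives of holomorphic functions *)

Section DerivativeHolomorphic.
Variable R : realType.
Local Notation C := (Cplx R).
Implicit Types (r M : R) (f : C -> C) (z w a b l : C).

(** The real mean value theorem is applied along the segment to the real and imaginary parts, whence
    the factor 2. *)
Lemma mean_value_bound f (df : C -> C) a b M :
  (forall t : R, 0 <= t <= 1 ->
     has_derivative f (a + toC t * (b - a)) (df (a + toC t * (b - a))) /\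
     modulus (df (a + toC t * (b - a))) <= M) ->
  modulus (f b - f a) <= 2 * M * modulus (b - a).
Proof.
move=> H; pose p t := a + toC t * (b - a).
have p0 : p 0 = a by rewrite /p toC0 mul0r addr0.
have p1 : p 1 = b by rewrite /p toC1 mul1r addrC subrK.
have B t : 0 <= t <= 1 -> modulus (df (p t) * (b - a)) <= M * modulus (b - a).
  by move=> /H [_ ?]; rewrite modulusM ler_wpM2r // modulus_ge0.
have Hre : `|re (f (p 1)) - re (f (p 0))| <= M * modulus (b - a) * (1 - 0).
  apply: (@increment_bound _ (fun t => re (f (p t))) (fun t => re (df (p t) * (b - a)))) => //.
    by move=> t /H [d _]; have [] := has_derivative_line d.
  by move=> t /B; apply: le_trans; exact: abs_re_le.
have Him : `|im (f (p 1)) - im (f (p 0))| <= M * modulus (b - a) * (1 - 0).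
  apply: (@increment_bound _ (fun t => im (f (p t))) (fun t => im (df (p t) * (b - a)))) => //.
    by move=> t /H [d _]; have [] := has_derivative_line d.
  by move=> t /B; apply: le_trans; exact: abs_im_le.
rewrite p0 p1 subr0 mulr1 in Hre Him.
apply: (le_trans (modulus_le _)); rewrite !(reD, imD, reN, imN).
by rewrite -mulrA mulr2n mulrDl mul1r lerD.
Qed.

Lemma segment_in_disk z a b r (t : R) : modulus (a - z) < r -> modulus (b - z) < r ->
  0 <= t <= 1 -> modulus (a + toC t * (b - a) - z) < r.
Proof.
move=> az bz /andP[t0 t1].
have -> : a + toC t * (b - a) - z = toC (1 - t) * (a - z) + toC t * (b - z).
  by rewrite toCD toCN toC1; ring.
apply: (le_lt_trans (modulusD _ _)).
rewrite !modulusM !modulus_toC !ger0_norm ?subr_ge0 //.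
have [->|tn0] := eqVneq t 0; first by rewrite subr0 mul1r mul0r addr0.
have tp : 0 < t by rewrite lt_neqAle eq_sym tn0.
have : t * modulus (b - z) < t * r by rewrite ltr_pM2l.
have : (1 - t) * modulus (a - z) <= (1 - t) * r by rewrite ler_wpM2l ?subr_ge0 // ltW.
lra.
Qed.

(* Convergence of a Cauchy family with an explicit rate [c], the limit being a
   supremum. *)
Lemma squeeze_exists (T : Type) (S : set T) (phi c : T -> R) :
  (forall h k, S h -> S k -> phi h - c h <= phi k + c k) ->
  exists L, forall h, S h -> `|phi h - L| <= c h.
Proof.
move=> H.
have [[h0 Sh0]|S0] := pselect (exists h, S h); last first.
  by exists 0 => h Sh; case: S0; exists h.
pose A := [set x | exists2 h, S h & x = phi h - c h].
exists (sup A) => h Sh.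
have h1 : phi h - c h <= sup A.
  apply: ub_le_sup; last by exists h.
  by exists (phi h0 + c h0) => _ [k Sk ->]; exact: H.
have h2 : sup A <= phi h + c h.
  apply: ge_sup; first by exists (phi h0 - c h0), h0.
  by move=> _ [k Sk ->]; exact: H.
by rewrite ler_norml; apply/andP; split; lra.
Qed.

Variables (f df : C -> C) (a : C) (rho : R).
Hypothesis rho0 : 0 < rho.
Hypothesis dfP : forall w, modulus (w - a) < rho -> has_derivative f w (df w).

Let near_trans z w r s t : modulus (z - w) < r -> modulus (w - a) < s -> r + s <= t ->
  modulus (z - a) < t.
Proof.
move=> zw wa rs; have -> : z - a = (z - w) + (w - a) by ring.
by apply: (le_lt_trans (modulusD _ _)); lra.
Qed.

(** By continuity [f] oscillates by at most 2 on a small disk, so Cauchy's estimate applies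
    uniformly to the points near [a]. *)
Lemma derivative_locally_bounded : exists M r, [/\ 0 < r, r <= rho, 0 <= M &
  forall w, modulus (w - a) < r -> modulus (df w) <= M].
Proof.
have da : has_derivative f a (df a) by apply: dfP; rewrite subrr modulus0.
have [d d0 dP] := has_derivative_continuous da ltr01.
(* Halving keeps the disk of radius [r] about each point [w] with [modulus (w - a) < r] inside both
   given disks. *)
pose r := Num.min d rho / 2.
have r0 : 0 < r by rewrite divr_gt0 // lt_min d0.
have rd : r + r <= d by rewrite /r; have : Num.min d rho <= d; [rewrite ge_min lexx|lra].
have rr : r + r <= rho by rewrite /r; have : Num.min d rho <= rho; [rewrite ge_min lexx orbT|lra].
clearbody r; exists (2 * 2 / (r / 2)), r; split => //; first lra.
  by rewrite divr_ge0 // divr_ge0 // ltW.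
move=> w wa; apply: (@Cauchy_estimate _ f w r).
- by move=> z zw; exists (df z); apply: dfP; exact: near_trans zw wa rr.
- by apply: dfP; lra.
- by apply/andP; split; lra.
move=> z zw; have za := near_trans zw wa rd; have wa' : modulus (w - a) < d by lra.
have := dP _ za; have := dP _ wa'.
have -> : f z - f w = (f z - f a) - (f w - f a) by ring.
by have := modulusB (f z - f a) (f w - f a); lra.
Qed.

(** The function [y |-> f y - f (y + (w - z))] has derivative [df z - df w] at [z]. Since [df] is
    bounded by [M], its values are at most [2 * M * modulus (z - w)], and Cauchy's estimate bounds
    the derivative by the oscillation. *)
Lemma derivative_locally_lipschitz : exists M r, [/\ 0 < r, r <= rho, 0 <= M &
  forall z w, modulus (z - a) < r -> modulus (w - a) < r ->
    modulus (df z - df w) <= M * modulus (z - w)].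
Proof.
have [M [r [r0 rr M0 dM]]] := derivative_locally_bounded.
have lip z w : modulus (z - a) < r -> modulus (w - a) < r ->
    modulus (f w - f z) <= 2 * M * modulus (w - z).
  move=> za wa; apply: (mean_value_bound (df := df)) => t t01.
  have := segment_in_disk za wa t01 => sa; split; last exact: dM.
  by apply: dfP; lra.
exists (2 * (4 * M) / (r / 4)), (r / 2); split; try lra.
  by rewrite divr_ge0 ?mulr_ge0 // ltW // divr_gt0.
move=> z w za wa.
have -> : 2 * (4 * M) / (r / 4) * modulus (z - w) = 2 * (4 * M * modulus (z - w)) / (r / 4).
  by field; rewrite lt0r_neq0.
have in1 y : modulus (y - z) < r / 2 -> modulus (y - a) < r.
  by move=> yz; apply: near_trans yz za _; lra.
have in2 y : modulus (y - z) < r / 2 -> modulus (y + (w - z) - a) < r.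
  move=> yz; apply: (@near_trans _ w _ _ _ _ wa (_ : r / 2 + r / 2 <= r)); last lra.
  by have -> : y + (w - z) - w = y - z by ring.
have dq y : modulus (y - z) < r / 2 ->
    has_derivative (fun y => f y - f (y + (w - z))) y (df y - df (y + (w - z))).
  move=> yz; apply: has_derivativeB.
    by apply: dfP; have := in1 y yz; lra.
  by apply: has_derivative_shift; apply: dfP; have := in2 y yz; lra.
have := dq z; rewrite subrr modulus0 (_ : z + (w - z) = w); last by ring.
move=> /(_ _)dqz; apply: (@Cauchy_estimate _ (fun y => f y - f (y + (w - z))) z (r / 2)).
- by move=> y /dq; exists (df y - df (y + (w - z))).
- by apply: dqz; lra.
- by apply/andP; split; lra.
move=> y yz; rewrite (_ : z + (w - z) = w); last by ring.
have zr : modulus (z - a) < r by lra.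
have wr : modulus (w - a) < r by lra.
have h1 := lip _ _ (in2 y yz) (in1 y yz); have h2 := lip _ _ wr zr.
have E : y - (y + (w - z)) = z - w by ring.
rewrite E in h1.
by apply: (le_trans (modulusB _ _)); lra.
Qed.

(** The difference quotients [dquot h] of [df] form a Cauchy family as [h] tends to 0. Indeed
    [dquot h - dquot k] is the derivative at [a] of [Phi], the difference of two difference
    quotients of [f]. Both are close to [df], so [Phi] is small and Cauchy's estimate applies. *)
Theorem derivative_has_derivative : exists l, has_derivative df a l.
Proof.
have [M [r [r0 rr M0 lipM]]] := derivative_locally_lipschitz.
have quot w (h : C) : modulus (w - a) < r / 2 -> modulus h < r / 2 -> h != 0 ->
    modulus ((f (w + h) - f w) / h - df w) <= 2 * M * modulus h.
  move=> wa hr h0; have hp : 0 < modulus h by rewrite modulus_gt0.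
  have wh : modulus (w + h - a) < r.
    apply: (@near_trans _ w (r / 2) (r / 2)) => //; last lra.
    by rewrite addrAC subrr add0r.
  have wr : modulus (w - a) < r by lra.
  (* Its derivative [df z - df w] is at most [M * modulus h] on the segment, by the Lipschitz
     bound. *)
  pose g z := f z - df w * z.
  have := @mean_value_bound g (fun z => df z - df w) w (w + h) (M * modulus h).
  rewrite addrAC subrr add0r => B.
  have -> : (f (w + h) - f w) / h - df w = (g (w + h) - g w) / h by rewrite /g; field.
  rewrite modulusM modulusV ler_pdivrMr // -(mulrA 2); apply: B => t t01.
  have sa : modulus (w + toC t * h - a) < r.
    by have := segment_in_disk wr wh t01; rewrite (_ : w + h - w = h) //; ring.
  split.
    apply: has_derivativeB; first by apply: dfP; lra.
    rewrite -[X in has_derivative _ _ X]mulr1; apply: has_derivativeZ.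
    exact: has_derivative_id.
  apply: (le_trans (lipM _ _ sa wr)); rewrite ler_wpM2l //.
  rewrite (_ : w + toC t * h - w = toC t * h); last by ring.
  rewrite modulusM modulus_toC; case/andP: t01 => t0 t1.
  by rewrite ger0_norm // ler_piMl // modulus_ge0.
(* [Phi] oscillates by at most [4 * M * (modulus h + modulus k)] on the disk of radius [r / 4];
   Cauchy's estimate is taken at radius [r / 8]. *)
pose K := 2 * (4 * M) / (r / 8).
have K0 : 0 <= K by rewrite /K divr_ge0 ?mulr_ge0 // ltW // divr_gt0.
pose dquot h := (df (a + h) - df a) / h.
pose S := [set h : C | modulus h < r / 4 /\ h != 0].
have cauchy h k : S h -> S k -> modulus (dquot h - dquot k) <= K * (modulus h + modulus k).
  move=> [hr h0] [kr k0].
  pose Phi w := (f (w + h) - f w) / h - (f (w + k) - f w) / k.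
  have PhiB w : modulus (w - a) < r / 4 -> modulus (Phi w) <= 2 * M * (modulus h + modulus k).
    move=> wa; have -> : Phi w = ((f (w + h) - f w) / h - df w) -
       ((f (w + k) - f w) / k - df w) by rewrite /Phi; ring.
    have wa' : modulus (w - a) < r / 2 by lra.
    have hr' : modulus h < r / 2 by lra.
    have kr' : modulus k < r / 2 by lra.
    have q1 := quot w h wa' hr' h0; have q2 := quot w k wa' kr' k0.
    by apply: (le_trans (modulusB _ _)); lra.
  have dPhi w : modulus (w - a) < r / 4 -> has_derivative Phi w
      ((df (w + h) - df w) / h - (df (w + k) - df w) / k).
    move=> wa.
    have D (m : C) : modulus m < r / 4 -> m != 0 -> has_derivative
        (fun w => (f (w + m) - f w) / m) w ((df (w + m) - df w) / m).
      move=> mr m0; rewrite mulrC.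
      apply: (@has_derivative_near _ (fun w => m^-1 * (f (w + m) - f w))).
        by exists 1 => // y _; rewrite mulrC.
      apply: has_derivativeZ; apply: has_derivativeB; last by apply: dfP; lra.
      apply: has_derivative_shift; apply: dfP.
      apply: (@near_trans _ w (r / 4) (r / 4)) => //; last lra.
      by rewrite addrAC subrr add0r.
    by apply: has_derivativeB; exact: D.
  have -> : K * (modulus h + modulus k) = 2 * (4 * M * (modulus h + modulus k)) / (r / 8).
    by rewrite /K; field; rewrite lt0r_neq0.
  have aa : modulus (a - a) < r / 4 by rewrite subrr modulus0; lra.
  apply: (@Cauchy_estimate _ Phi a (r / 4)).
  - by move=> w /dPhi ?; eexists; eassumption.
  - exact: dPhi.
  - by apply/andP; split; lra.
  move=> w /PhiB; have := PhiB a aa; have := modulusB (Phi w) (Phi a); lra.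
have [Lr LrP] : exists L, forall h, S h -> `|re (dquot h) - L| <= K * modulus h.
  apply: squeeze_exists => h k Sh Sk.
  have := le_trans (abs_re_le _) (cauchy h k Sh Sk); rewrite reD reN.
  by have := ler_norm (re (dquot h) - re (dquot k)); lra.
have [Li LiP] : exists L, forall h, S h -> `|im (dquot h) - L| <= K * modulus h.
  apply: squeeze_exists => h k Sh Sk.
  have := le_trans (abs_im_le _) (cauchy h k Sh Sk); rewrite imD imN.
  by have := ler_norm (im (dquot h) - im (dquot k)); lra.
exists (mkC Lr Li) => e e0.
(* The real and imaginary parts each contribute an error [K]; adding 1 makes the divisor positive
   when [K = 0]. *)
have K1 : 0 < 2 * K + 1 by lra.
exists (Num.min (r / 4) (e / (2 * K + 1))); first by rewrite lt_min !divr_gt0.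
move=> w; rewrite lt_min (ltr_pdivlMr _ _ K1) => /andP[w1 w2].
have [->|wa] := eqVneq w a; first by rewrite !subrr mulr0 subrr modulus0 mulr0.
have h0 : w - a != 0 by rewrite subr_eq0.
have Sh : S (w - a) by split.
have -> : df w - df a - mkC Lr Li * (w - a) = (dquot (w - a) - mkC Lr Li) * (w - a).
  by rewrite /dquot (_ : a + (w - a) = w); [field|ring].
rewrite modulusM ler_wpM2r ?modulus_ge0 //.
apply: (le_trans (modulus_le _)); rewrite !(reD, imD, reN, imN) /=.
have := LrP _ Sh; have := LiP _ Sh; have := modulus_ge0 (w - a); lra.
Qed.

End DerivativeHolomorphic.

(** * Complex powers and Moebius transformations *)

Section Powers.
Variable R : realType.
Local Notation C := (Cplx R).
Implicit Types (x y : R) (z w tau : C) (g : 'M[R]_2).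

(** The sine of the arccosine gives only the absolute value of [im z / modulus z]; the case
    distinction in [carg] restores the sign. *)
Lemma cexp_clog z : z != 0 -> cexp (clog z) = z.
Proof.
move=> z0; have m0 : 0 < modulus z by rewrite modulus_gt0.
have m2 : re z ^+ 2 + im z ^+ 2 = modulus z ^+ 2.
  by rewrite modulusE sqr_sqrtr // addr_ge0 ?sqr_ge0.
have u1 : -1 <= re z / modulus z <= 1.
  rewrite -ler_norml normrM normfV (gtr0_norm m0) ler_pdivrMr // mul1r.
  exact: abs_re_le.
have s : Num.sqrt (1 - (re z / modulus z) ^+ 2) = `|im z| / modulus z.
  have -> : 1 - (re z / modulus z) ^+ 2 = (im z / modulus z) ^+ 2.
    apply/esym/eqP; rewrite eq_sym subr_eq !expr_div_n -mulrDl addrC m2 divff //.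
    by rewrite expf_neq0 // lt0r_neq0.
  by rewrite sqrtr_sqr normrM normfV (gtr0_norm m0).
have ck : cos (acos (re z / modulus z)) = re z / modulus z.
  by rewrite acosK // in_itv.
rewrite /cexp /clog re_mkC im_mkC lnK ?posrE // /carg.
apply: Cplx_ext; rewrite !(reM, imM) /= !mul0r ?subr0 ?addr0.
  by case: ifP => _; rewrite ?cosN ck mulrC divfK // lt0r_neq0.
case: ifP => [i0|/negbT]; last rewrite -ltNge => i0.
  by rewrite sin_acos // s ger0_norm // mulrC divfK // lt0r_neq0.
by rewrite sinN sin_acos // s ltr0_norm // mulNr opprK mulrC divfK // lt0r_neq0.
Qed.

Lemma cpowD z x y : cpow z (x + y) = cpow z x * cpow z y.
Proof. by rewrite /cpow toCD mulrDl cexpD. Qed.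

Lemma cpow1 z : z != 0 -> cpow z 1 = z.
Proof. by move=> z0; rewrite /cpow toC1 mul1r cexp_clog. Qed.

Lemma cpow0 z : cpow z 0 = 1.
Proof. by rewrite /cpow toC0 mul0r cexp0. Qed.

Lemma cpow_neq0 z x : cpow z x != 0.
Proof. exact: cexp_neq0. Qed.

Lemma cpowN1 z : z != 0 -> cpow z (-1) = z^-1.
Proof.
move=> z0; apply: (mulIf z0); rewrite mulVf // -[X in _ * X](cpow1 z0).
by rewrite -cpowD addNr cpow0.
Qed.

(** Within distance [|im z|] of [z] the imaginary part keeps its sign, so [carg] is a fixed sign
    times a continuous arccosine. *)
Lemma clog_continuous z : im z != 0 -> forall e, 0 < e ->
  exists2 d : R, 0 < d & forall w, modulus (w - z) < d -> modulus (clog w - clog z) < e.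
Proof.
move=> iz e e0.
have z0 : z != 0 by apply: contra_neq iz => ->.
have m0 : 0 < modulus z by rewrite modulus_gt0.
have cmod : {for z, continuous (@modulus R)}.
  move=> A /nbhs_ballP [d /= d0 dA]; apply/nbhs_CplxP; exists d => // w wz.
  apply: dA; rewrite -ball_normE /ball_ /= distrC; apply: le_lt_trans wz.
  rewrite ler_norml; apply/andP; split.
    have := modulusD (z - w) w; rewrite subrK modulusC; lra.
  have := modulusD (w - z) z; rewrite subrK; lra.
have cln : {for z, continuous (fun w => ln (modulus w))}.
  by apply: continuous_comp; [exact: cmod|exact: continuous_ln].
have u1 : -1 < re z / modulus z < 1.
  rewrite -ltr_norml normrM normfV (gtr0_norm m0) ltr_pdivrMr // mul1r.
  rewrite modulusE -sqrtr_sqr ltr_sqrt; first by rewrite ltrDl exprn_even_gt0.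
  by rewrite ltr_wpDl ?sqr_ge0 // exprn_even_gt0.
have cac : {for z, continuous (fun w => acos (re w / modulus w))}.
  apply: (@continuous_comp _ _ _ (fun w => re w / modulus w) (@acos R)); last exact: continuous_acos.
  have c1 : {for z, continuous (@re R)} by exact: continuous_re.
  have c2 : {for z, continuous (fun w => (modulus w)^-1)}.
    by apply: (@cvgV _ _ (nbhs z)); [exact: lt0r_neq0|exact: cmod].
  exact: continuousM c1 c2.
have e2 : 0 < e / 2 by rewrite divr_gt0.
have toP (h : C -> R) : {for z, continuous h} ->
    exists2 d : R, 0 < d & forall w, modulus (w - z) < d -> `|h w - h z| < e / 2.
  move=> ch; have /nbhs_CplxP [d d0 dP] := ch _ (nbhsx_ballx (h z) _ e2).
  by exists d => // w /dP; rewrite /= -ball_normE /ball_ /= distrC.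
have [d1 d10 P1] := toP _ cln; have [d2 d20 P2] := toP _ cac.
have in0 : 0 < `|im z| by rewrite normr_gt0.
exists (Num.min `|im z| (Num.min d1 d2)); first by rewrite !lt_min in0 d10.
move=> w; rewrite !lt_min => /and3P[w0 /P1 w1 /P2 w2].
apply: (le_lt_trans (modulus_le _)); rewrite !(reD, imD, reN, imN) /=.
rewrite (splitr e) ltrD //.
have {}w0 : `|im w - im z| < `|im z|.
  by apply: le_lt_trans w0; rewrite -imN -imD abs_im_le.
have -> : `|carg w - carg z| = `|acos (re w / modulus w) - acos (re z / modulus z)|.
  rewrite /carg; case: (leP 0 (im z)) => hz; case: (leP 0 (im w)) => hw //.
  - exfalso; move: w0; rewrite (ger0_norm hz) distrC => /(le_lt_trans (ler_norm _)); lra.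
  - exfalso; move: w0; rewrite (ltr0_norm hz) => /(le_lt_trans (ler_norm _)); lra.
  - by rewrite -normrN opprB addrC opprK.
exact: w2.
Qed.

(** This is the inverse function argument: [cexp] has the nonzero derivative [z] at [clog z], and
    [clog] is a continuous right inverse. *)
Lemma has_derivative_clog z : im z != 0 -> has_derivative (@clog R) z z^-1.
Proof.
move=> iz e e0.
have z0 : z != 0 by apply: contra_neq iz => ->.
have m0 : 0 < modulus z by rewrite modulus_gt0.
(* With [U], [V], [W], [m] as set below, the first bound absorbs [e1 * U] into [m * U] and yields
   [m * U <= 2 * W]; the second turns this into [V <= e * W]. *)
pose e1 := Num.min (modulus z / 2) (e * modulus z ^+ 2 / 2).
have e10 : 0 < e1 by rewrite lt_min !divr_gt0 // mulr_gt0 // exprn_gt0.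
have e11 : e1 <= modulus z / 2 by rewrite ge_min lexx.
have e12 : e1 <= e * modulus z ^+ 2 / 2 by rewrite ge_min lexx orbT.
clearbody e1.
have [d1 d10 P1] := has_derivative_cexp (clog z) e10.
have [d2 d20 P2] := clog_continuous iz d10.
exists (Num.min d2 (modulus z)); first by rewrite lt_min d20.
move=> w; rewrite lt_min => /andP[w2 wz].
have w0 : w != 0.
  by apply/eqP => w0; move: wz; rewrite w0 sub0r modulusN ltxx.
have := P1 _ (P2 _ w2); rewrite !cexp_clog //.
set u := clog w - clog z.
have -> : w - z - z * u = - (z * (u - z^-1 * (w - z))) by field.
rewrite modulusN modulusM; set v := u - _ => H.
have uE : u = v + z^-1 * (w - z) by rewrite /v; ring.
have : modulus u <= modulus v + (modulus z)^-1 * modulus (w - z).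
  by rewrite {1}uE (le_trans (modulusD _ _)) // modulusM modulusV.
set U := modulus u in H *; set V := modulus v in H *; set W := modulus (w - z).
set m := modulus z in m0 H e11 e12 *.
have U0 : 0 <= U by exact: modulus_ge0.
have W0 : 0 <= W by exact: modulus_ge0.
move=> HU; have mU : m * U <= m * V + W.
  by have := HU; rewrite -(ler_pM2l m0) mulrDr mulrA divff ?mul1r // lt0r_neq0.
have eU : e1 * U <= m / 2 * U by rewrite ler_wpM2r.
have {}mU : m * U <= 2 * W by lra.
have eU2 : e1 * (m * U) <= e1 * (2 * W) by rewrite ler_wpM2l // ltW.
have eW : e1 * W <= e * m ^+ 2 / 2 * W by rewrite ler_wpM2r.
have mm0 : 0 < m ^+ 2 by rewrite exprn_gt0.
have mH : m * (m * V) <= m * (e1 * U) by rewrite ler_pM2l.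
rewrite -(ler_pM2l mm0) expr2; move: eU2 eW mH; rewrite expr2.
have -> : e1 * (m * U) = m * (e1 * U) by ring.
have -> : m * m * V = m * (m * V) by ring.
lra.
Qed.

Lemma has_derivativeV (f : C -> C) z l : f z != 0 -> has_derivative f z l ->
  has_derivative (fun w => (f w)^-1) z (- (f z) ^- 2 * l).
Proof.
move=> fz /is_derive_CplxP [df dl]; apply/is_derive_CplxP; split.
  exact: derivableV.
by rewrite deriveV // dl.
Qed.

Lemma has_derivative_automorphy g tau :
  has_derivative (automorphy g) tau (toC (g 1 0)).
Proof.
rewrite -[X in has_derivative _ _ X]addr0; apply: has_derivativeD; last exact: has_derivative_cst.
rewrite -[X in has_derivative _ _ X]mulr1; apply: has_derivativeZ.
exact: has_derivative_id.
Qed.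

Lemma im_automorphy g tau : im (automorphy g tau) = g 1 0 * im tau.
Proof. by rewrite /automorphy imD imM /= mul0r !addr0. Qed.

Lemma re_automorphy g tau : re (automorphy g tau) = g 1 0 * re tau + g 1 1.
Proof. by rewrite /automorphy reD reM /= mul0r subr0. Qed.

Lemma det_SL2 g : \det g = g 0 0 * g 1 1 - g 0 1 * g 1 0.
Proof.
rewrite (expand_det_row _ 0) !big_ord_recr big_ord0 /= add0r /cofactor !det_mx11 !mxE /=.
have -> : widen_ord (leqnSn 1) ord_max = 0 :> 'I_2 by apply/val_inj.
have -> : ord_max = 1 :> 'I_2 by apply/val_inj.
have -> : lift 0 (0 : 'I_1) = 1 :> 'I_2 by apply/val_inj.
have -> : lift 1 (0 : 'I_1) = 0 :> 'I_2 by apply/val_inj.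
rewrite /=; ring.
Qed.

Lemma automorphy_neq0 g tau : \det g = 1 -> upper tau -> automorphy g tau != 0.
Proof.
rewrite det_SL2 /upper /= => dg it.
apply/eqP => J0; have := im_automorphy g tau; have := re_automorphy g tau.
rewrite J0 /= => hr /esym/eqP; rewrite mulf_eq0 (gt_eqF it) orbF => /eqP c0.
move: dg hr; rewrite c0 mulr0 mul0r subr0 add0r => dg d0.
by move: dg; rewrite -d0 mulr0 => /esym/eqP; rewrite oner_eq0.
Qed.

Lemma mobius_upper g tau : \det g = 1 -> upper tau -> upper (mobius g tau).
Proof.
move=> dg it; have J0 := automorphy_neq0 dg it.
have m0 : 0 < modulus (automorphy g tau) by rewrite modulus_gt0.
have n0 : 0 < re (automorphy g tau) ^+ 2 + im (automorphy g tau) ^+ 2.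
  by have := m0; rewrite modulusE sqrtr_gt0.
rewrite /upper /= /mobius.
set N := _ + _; have Nre : re N = g 0 0 * re tau + g 0 1 by rewrite /N reD reM /= mul0r subr0.
have Nim : im N = g 0 0 * im tau by rewrite /N imD imM /= mul0r !addr0.
have -> : im (N / automorphy g tau) = im tau * \det g /
    (re (automorphy g tau) ^+ 2 + im (automorphy g tau) ^+ 2).
  rewrite imM Nre Nim.
  have -> : re (automorphy g tau)^-1 = re (automorphy g tau) /
    (re (automorphy g tau) ^+ 2 + im (automorphy g tau) ^+ 2) by case: (automorphy g tau).
  have -> : im (automorphy g tau)^-1 = - (im (automorphy g tau) /
    (re (automorphy g tau) ^+ 2 + im (automorphy g tau) ^+ 2)).
    by case: (automorphy g tau) => a b; rewrite /im /re /=; ring.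
  by rewrite det_SL2 !(im_automorphy, re_automorphy); ring.
by rewrite dg mulr1 divr_gt0.
Qed.

Lemma has_derivative_mobius g tau : \det g = 1 -> upper tau ->
  has_derivative (mobius g) tau (automorphy g tau ^- 2).
Proof.
move=> dg it; have J0 := automorphy_neq0 dg it.
have dN : has_derivative (fun w => toC (g 0 0) * w + toC (g 0 1)) tau (toC (g 0 0)).
  rewrite -[X in has_derivative _ _ X]addr0; apply: has_derivativeD; last exact: has_derivative_cst.
  rewrite -[X in has_derivative _ _ X]mulr1; apply: has_derivativeZ.
  exact: has_derivative_id.
have := has_derivativeM dN (has_derivativeV J0 (has_derivative_automorphy g tau)).
congr has_derivative.
have E : toC (g 0 0) * toC (g 1 1) - toC (g 0 1) * toC (g 1 0) = 1.
  by rewrite -!toCM -toCN -toCD -det_SL2 dg.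
transitivity ((toC (g 0 0) * toC (g 1 1) - toC (g 0 1) * toC (g 1 0)) /
    automorphy g tau ^+ 2); last by rewrite E mul1r.
by rewrite /=; move: J0; rewrite /automorphy => J0; field.
Qed.

Lemma has_derivative_cpow_automorphy g tau x : \det g = 1 -> upper tau ->
  has_derivative (fun w => cpow (automorphy g w) x) tau
    (toC x * (toC (g 1 0) / automorphy g tau) * cpow (automorphy g tau) x).
Proof.
(* If [c = 0], the factor is constant but may be a negative real number, on the branch cut of
   [clog]; otherwise it is non-real on the upper half-plane. *)
move=> dg it; have [c0|c0] := eqVneq (g 1 0) 0.
  rewrite c0 toC0 mul0r mulr0 mul0r.
  have -> : (fun w => cpow (automorphy g w) x) = fun=> cpow (toC (g 1 1)) x.
    by apply/funext => w; rewrite /automorphy c0 toC0 mul0r add0r.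
  exact: has_derivative_cst.
have iJ : im (automorphy g tau) != 0.
  by rewrite im_automorphy mulf_neq0 // gt_eqF.
rewrite mulrC; apply: (has_derivative_comp (g := fun w => toC x * clog (automorphy g w))).
  apply: has_derivativeZ; rewrite mulrC.
  exact: (has_derivative_comp (has_derivative_automorphy g tau) (has_derivative_clog iJ)).
exact: has_derivative_cexp.
Qed.

End Powers.

(** * Iterated derivatives of f|_k g *)

Section SlashDerivatives.
Variable R : realType.
Local Notation C := (Cplx R).
Implicit Types (x k : R) (z w tau l : C) (f h : C -> C) (g : 'M[R]_2) (m n r j : nat).

Lemma twopii_neq0 : twopii R != 0.
Proof.
apply/eqP => /(congr1 (@im R)) /= /eqP.
by rewrite mulf_eq0 pnatr_eq0 /= gt_eqF // pi_gt0.
Qed.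

Lemma upper_open tau : upper tau ->
  exists2 d : R, 0 < d & forall w, modulus (w - tau) < d -> upper w.
Proof.
rewrite /upper /= => it; exists (im tau) => // w.
move=> /(le_lt_trans (abs_im_le _)); rewrite imD imN -normrN opprB.
by move=> /(le_lt_trans (ler_norm _)); rewrite /upper /=; lra.
Qed.

Lemma holomorphicP f : holomorphic_upper f <->
  forall tau, upper tau -> has_derivative f tau (derive1 f tau).
Proof.
split=> H tau /H; last by move=> /is_derive_CplxP [].
move=> df; apply: (is_derive_CplxP _ _ _).1; split; first exact: df.
by rewrite derive1E.
Qed.

Lemma holomorphic_derive1 f : holomorphic_upper f -> holomorphic_upper (derive1 f).
Proof.
move=> /holomorphicP df tau it; have [d d0 dP] := upper_open it.
have [l /is_derive_CplxP [] //] := derivative_has_derivative d0 (fun w wd => df w (dP w wd)).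
Qed.

Lemma holomorphic_D f : holomorphic_upper f -> holomorphic_upper (D f).
Proof.
move=> /holomorphic_derive1/holomorphicP df; move=> tau it.
have /is_derive_CplxP [//] := has_derivativeZ (twopii R)^-1 (df _ it).
Qed.

Lemma holomorphic_iterD f r : holomorphic_upper f -> holomorphic_upper (iter r (@D R) f).
Proof. by move=> hf; elim: r => [|r IH]; [exact: hf|exact: (holomorphic_D IH)]. Qed.

(** [D] is total, so an equation for [D f tau] would not record differentiability; this predicate
    carries both. *)
Definition has_D f tau l := has_derivative f tau (twopii R * l).

Lemma has_D_eq f tau l : has_D f tau l -> D f tau = l.
Proof.
move=> /is_derive_CplxP [_]; rewrite -derive1E /D => ->.
by rewrite mulKf // twopii_neq0.
Qed.

Lemma has_D_holomorphic f tau : holomorphic_upper f -> upper tau ->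
  has_D f tau (D f tau).
Proof.
by move=> /holomorphicP hf it; rewrite /has_D /D mulVKf ?twopii_neq0 //; exact: hf.
Qed.

Lemma has_D_upper f h tau l : (forall w, upper w -> f w = h w) -> upper tau ->
  has_D f tau l -> has_D h tau l.
Proof.
move=> fh it; apply: has_derivative_near.
by have [d d0 dP] := upper_open it; exists d => // w /dP /fh.
Qed.

Lemma has_D_M f h tau l l' : has_D f tau l -> has_D h tau l' ->
  has_D (fun w => f w * h w) tau (l * h tau + f tau * l').
Proof.
rewrite /has_D => df dh; have := has_derivativeM df dh.
by congr has_derivative; ring.
Qed.

Lemma has_D_Z f tau l c : has_D f tau l -> has_D (fun w => c * f w) tau (c * l).
Proof. by move=> df; rewrite /has_D mulrCA; exact: has_derivativeZ. Qed.

Lemma has_D_sum (I : Type) (s : seq I) (F : I -> C -> C) (dF : I -> C) tau :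
  (forall i, has_D (F i) tau (dF i)) ->
  has_D (fun w => \sum_(i <- s) F i w) tau (\sum_(i <- s) dF i).
Proof.
move=> dFP; elim: s => [|i s IH].
  rewrite big_nil /has_D mulr0.
  under [X in has_derivative X]eq_fun => w do rewrite big_nil.
  exact: has_derivative_cst.
under [X in has_D X]eq_fun => w do rewrite big_cons.
by rewrite big_cons /has_D mulrDr; exact: has_derivativeD (dFP i) IH.
Qed.

Lemma has_D_X f tau l n : has_D f tau l ->
  has_D (fun w => f w ^+ n) tau (n%:R * f tau ^+ n.-1 * l).
Proof.
move=> df; elim: n => [|n IH].
  rewrite mul0r mul0r /has_D mulr0.
  under [X in has_derivative X]eq_fun => w do rewrite expr0.
  exact: has_derivative_cst.
under [X in has_D X]eq_fun => w do rewrite exprS.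
have := has_D_M df IH; congr has_D; rewrite /= -(addn1 n) natrD.
case: n {IH} => [|n]; first by rewrite !expr0; ring.
by rewrite /= !exprS; ring.
Qed.

(* The quantity X of the header. *)
Definition slope g tau : C :=
  - ((twopii R)^-1 * (toC (g 1 0) / automorphy g tau)).

Lemma has_D_slope g tau : \det g = 1 -> upper tau ->
  has_D (slope g) tau (slope g tau ^+ 2).
Proof.
move=> dg it; have J0 := automorphy_neq0 dg it.
have := has_derivativeZ (- ((twopii R)^-1 * toC (g 1 0)))
  (has_derivativeV J0 (has_derivative_automorphy g tau)).
have -> : (fun w => - ((twopii R)^-1 * toC (g 1 0)) * (automorphy g w)^-1) = slope g.
  by apply/funext => w; rewrite /slope mulrA mulNr.
rewrite /has_D /slope; congr has_derivative.
by have t0 := twopii_neq0; field; apply/andP.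
Qed.

Lemma has_D_factor g tau x : \det g = 1 -> upper tau ->
  has_D (fun w => cpow (automorphy g w) x) tau
    (- toC x * slope g tau * cpow (automorphy g tau) x).
Proof.
move=> dg it; have := has_derivative_cpow_automorphy x dg it.
congr has_derivative; rewrite /slope.
by have t0 := twopii_neq0; have J0 := automorphy_neq0 dg it; field; apply/andP.
Qed.

Lemma has_D_mobius f g tau : \det g = 1 -> holomorphic_upper f -> upper tau ->
  has_D (fun w => f (mobius g w)) tau
    (cpow (automorphy g tau) (-2) * D f (mobius g tau)).
Proof.
move=> dg hf it.
have := has_derivative_comp (has_derivative_mobius dg it)
  (has_D_holomorphic hf (mobius_upper dg it)).
congr has_derivative.
have -> : -2 = -1 + -1 :> R by ring.
by rewrite cpowD cpowN1 ?automorphy_neq0 // expr2 invfM; ring.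
Qed.

Lemma risingS x n : rising x n.+1 = rising x n * (x + n%:R).
Proof. by rewrite /rising big_ord_recr. Qed.

Lemma risingSl x n : rising x n.+1 = x * rising (x + 1) n.
Proof.
rewrite /rising big_ord_recl addr0; congr (_ * _); apply: eq_bigr => i _.
by rewrite /= /bump leq0n natrD addrA.
Qed.

Definition slash_coef k m r : R := 'C(m, r)%:R * rising (k + r%:R) (m - r).

Lemma slash_coef_recl k m :
  slash_coef k m 0 * (k + m%:R) = slash_coef k m.+1 0.
Proof. by rewrite /slash_coef !bin0 !subn0 addr0 !mul1r risingS. Qed.

(** The recursion produced by one more derivative. The term of index [s.+1] keeps its index and
    gains the total weight [k + m + s.+1], while differentiating the [s]-th derivative of [f] moves
    index [s] to [s.+1]. *)
Lemma slash_coef_rec k m s : (s <= m)%N ->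
  slash_coef k m s.+1 * (k + m%:R + s.+1%:R) + slash_coef k m s =
  slash_coef k m.+1 s.+1.
Proof.
rewrite /slash_coef leq_eqVlt => /predU1P[->|sm].
  by rewrite bin_small // !subnn !binn !mul0r add0r /rising !big_ord0.
have -> : (m - s = (m - s.+1).+1)%N by rewrite -subSn.
have -> : (m.+1 - s.+1 = (m - s.+1).+1)%N by rewrite subSS -subSn.
rewrite [rising (k + s%:R) _]risingSl [rising (k + s.+1%:R) (_.+1)]risingS.
have -> : k + s%:R + 1 = k + s.+1%:R by rewrite -addrA -natr1.
rewrite binS natrD.
(* The only relation needed between the two binomial coefficients; what remains is polynomial. *)
have Hb : (s.+1%:R : R) * 'C(m, s.+1)%:R = (m%:R - s%:R) * 'C(m, s)%:R.
  by rewrite -natrB ?(ltnW sm) // -!natrM mul_bin_left.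
have -> : (m - s.+1)%:R = m%:R - s.+1%:R :> R by rewrite natrB.
move: Hb; rewrite -natr1; set A := rising _ _; move: A => A.
move: ('C(m, s.+1)%:R) ('C(m, s)%:R) (m%:R) (s%:R) => B B' M S Hb.
have -> : B * A * (k + M + (S + 1)) + B' * ((k + S) * A) =
   A * ((S + 1) * B) + A * (B * (k + M)) + B' * ((k + S) * A) by ring.
by rewrite Hb; ring.
Qed.

Lemma iterD_slash f g k m tau : \det g = 1 -> holomorphic_upper f -> upper tau ->
  iter m (@D R) (slash k f g) tau =
  \sum_(r < m.+1) toC (slash_coef k m r) * slope g tau ^+ (m - r) *
    cpow (automorphy g tau) (- k - 2 * r%:R) * iter r (@D R) f (mobius g tau).
Proof.
move=> dg hf; elim: m tau => [|m IH] tau it.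
  rewrite big_ord_recl big_ord0 /= addr0 mulr0 subr0 subn0 expr0 mulr1.
  by rewrite /slash_coef bin0 /rising big_ord0 mulr1 toC1 mul1r.
rewrite iterS; pose P r w := cpow (automorphy g w) (- k - 2 * r%:R).
pose F r w := iter r (@D R) f (mobius g w).
have PS r : P r.+1 tau = P r tau * cpow (automorphy g tau) (-2).
  by rewrite /P -cpowD; congr cpow; rewrite -natr1; ring.
pose T (r : nat) w := toC (slash_coef k m r) * (slope g w ^+ (m - r) * (P r w * F r w)).
(* The power of [slope] contributes the weight [m - r] and the automorphy factor [k + 2 * r]; each
   raises the power of [slope] by one, and the weights add up to [k + m + r]. *)
have dT (r : 'I_m.+1) : has_D (T r) tau (toC (slash_coef k m r) *
    (toC (k + m%:R + r%:R) * slope g tau ^+ (m.+1 - r) * (P r tau * F r tau) +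
     slope g tau ^+ (m - r) * (P r.+1 tau * F r.+1 tau))).
  apply: has_D_Z.
  have dF := has_D_mobius dg (holomorphic_iterD (r := r) hf) it.
  have := has_D_M (has_D_X (m - r) (has_D_slope dg it))
    (has_D_M (has_D_factor (- k - 2 * r%:R) dg it) dF).
  congr has_D; rewrite PS -/(P r tau) -/(F r tau) /F iterS.
  have rm : (r <= m)%N by rewrite -ltnS.
  have -> : toC (- k - 2 * r%:R) = - (toC k + 2 * r%:R) :> C.
    by rewrite toCD !toCN toCM !toC_nat; ring.
  have -> : toC (k + m%:R + r%:R) = toC k + (m - r)%:R + 2 * r%:R :> C.
    by rewrite !toCD !toC_nat -{1}(subnK rm) natrD; ring.
  rewrite subSn // exprS.
  case: (m - r)%N => [|p]; first by rewrite !expr0; ring.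
  by rewrite /= !exprS; ring.
rewrite (@has_D_eq _ _ (\sum_(r < m.+1) toC (slash_coef k m r) *
    (toC (k + m%:R + r%:R) * slope g tau ^+ (m.+1 - r) * (P r tau * F r tau) +
     slope g tau ^+ (m - r) * (P r.+1 tau * F r.+1 tau)))); last first.
  apply: (@has_D_upper (fun w => \sum_(r < m.+1) T r w)) it _.
    move=> w iw; rewrite IH //; apply: eq_bigr => r _.
    by rewrite /T /P /F !mulrA.
  by apply: has_D_sum => r; exact: dT.
pose Y r := slope g tau ^+ (m.+1 - r) * (P r tau * F r tau).
transitivity (\sum_(r < m.+1) toC (slash_coef k m r * (k + m%:R + r%:R)) * Y r +
              \sum_(r < m.+1) toC (slash_coef k m r) * Y r.+1).
  rewrite -big_split; apply: eq_bigr => r _ /=.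
  by rewrite /Y toCM subSS; ring.
transitivity (\sum_(r < m.+2) toC (slash_coef k m.+1 r) * Y r); last first.
  by apply: eq_bigr => r _; rewrite /Y /P /F !mulrA.
rewrite [RHS]big_ord_recl.
(* The added term [r = m.+1] vanishes with its binomial coefficient; it aligns the first sum with
   the shifted second one. *)
transitivity (\sum_(r < m.+2) toC (slash_coef k m r * (k + m%:R + r%:R)) * Y r +
              \sum_(r < m.+1) toC (slash_coef k m r) * Y r.+1).
  rewrite [in RHS]big_ord_recr /= [slash_coef k m m.+1]/slash_coef bin_small //.
  by rewrite !mul0r addr0.
rewrite [X in X + _ = _]big_ord_recl /= addr0 slash_coef_recl -addrA; congr (_ + _).
rewrite -big_split; apply: eq_bigr => r _ /=.
by rewrite /bump leq0n add1n -mulrDl -toCD slash_coef_rec // -ltnS.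
Qed.

Lemma iterD_pow w n r : iter r (@D R) (fun z => (z - w) ^+ n) =
  fun z => (twopii R)^-1 ^+ r * (n ^_ r)%:R * (z - w) ^+ (n - r).
Proof.
elim: r => [|r IH]; first by apply/funext => z; rewrite expr0 ffactn0 !mul1r subn0.
rewrite iterS IH; apply/funext => z; apply: has_D_eq.
have dw : has_D (fun z => z - w) z (twopii R)^-1.
  rewrite /has_D divff ?twopii_neq0 // -[X in has_derivative _ _ X]subr0.
  by apply: has_derivativeB; [exact: has_derivative_id|exact: has_derivative_cst].
have := has_D_Z ((twopii R)^-1 ^+ r * (n ^_ r)%:R) (has_D_X (n - r) dw).
by congr has_D; rewrite ffactnSr natrM exprS subnS; ring.
Qed.

(** These powers are the test functions that isolate a single coefficient of an operator. *)
Lemma iterD_pow_center w n r : iter r (@D R) (fun z => (z - w) ^+ n) w =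
  if r == n then (twopii R)^-1 ^+ n * n`!%:R else 0.
Proof.
rewrite iterD_pow subrr; case: ltngtP => [rn|nr|->].
- by rewrite expr0n subn_eq0 leqNgt rn mulr0.
- by rewrite ffact_small // mulr0 mul0r.
- by rewrite subnn expr0 mulr1 ffactnn.
Qed.

Lemma holomorphic_pow w n : holomorphic_upper (fun z => (z - w) ^+ n).
Proof.
move=> tau _; have dw : has_D (fun z => z - w) tau (twopii R)^-1.
  rewrite /has_D divff ?twopii_neq0 // -[X in has_derivative _ _ X]subr0.
  by apply: has_derivativeB; [exact: has_derivative_id|exact: has_derivative_cst].
by have /is_derive_CplxP [] := has_D_X n dw.
Qed.

End SlashDerivatives.

(** * Equivariance *)

Section Equivariance.
Variable R : realType.
Local Notation C := (Cplx R).
Implicit Types (k : R) (K : int) (tau w : C) (f : C -> C) (a b : nat -> C -> C).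
Implicit Types (g sigma : 'M[R]_2) (G : set 'M[R]_2) (m n r : nat).

(** Regroups the terms of an operator by the order [r] of the derivative falling on [f] instead of
    the order [m] in the operator. *)
Lemma triangular_exchange (V : zmodType) n (B : nat -> nat -> V) :
  \sum_(m < n.+1) \sum_(r < m.+1) B m r =
  \sum_(r < n.+1) \sum_(j < (n - r).+1) B (r + j)%N r.
Proof.
transitivity (\sum_(m < n.+1) \sum_(r < n.+1 | (r < m.+1)%N) B m r).
  by apply: eq_bigr => m _; rewrite (big_ord_widen n.+1).
rewrite (exchange_big_dep xpredT) //=; apply: eq_bigr => r _.
have rn : (r <= n)%N by rewrite -ltnS.
rewrite -subSn // -(big_mkord xpredT (fun j => B (r + j)%N r)).
under [RHS]eq_bigr => j _ do rewrite addnC.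
rewrite -(big_addn 0 n.+1 r xpredT (fun m => B m r)) add0n big_geq_mkord.
by apply: eq_bigl => m; rewrite /= ltnS.
Qed.

(** The right-hand side of [coefficient_law], with its base written as [slope]. *)
Definition transformed_coef k n a g r tau : C :=
  \sum_(j < (n - r).+1) 'C(r + j, j)%:R * toC (rising (k + r%:R) j) *
    slope g tau ^+ j * a (r + j)%N tau.

Lemma diff_op_slash k n a f g tau : \det g = 1 -> holomorphic_upper f ->
  upper tau ->
  diff_op n a (slash k f g) tau =
  \sum_(r < n.+1) cpow (automorphy g tau) (- k - 2 * r%:R) *
    iter r (@D R) f (mobius g tau) * transformed_coef k n a g r tau.
Proof.
move=> dg hf it; rewrite /diff_op.
pose B m r := a m tau * (toC (slash_coef k m r) * slope g tau ^+ (m - r) *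
    cpow (automorphy g tau) (- k - 2 * r%:R) * iter r (@D R) f (mobius g tau)).
transitivity (\sum_(m < n.+1) \sum_(r < m.+1) B m r).
  by apply: eq_bigr => m _; rewrite iterD_slash // mulr_sumr.
rewrite triangular_exchange; apply: eq_bigr => r _.
rewrite /transformed_coef mulr_sumr; apply: eq_bigr => j _.
rewrite /B /slash_coef addKn toCM toC_nat.
have -> : 'C(r + j, r) = 'C(r + j, j) by rewrite -[in RHS]bin_sub ?leq_addl // addnK.
by ring.
Qed.

(** Splitting the weight [k + K] as [(k + 2 * r) + (K - 2 * r)] gives the [r]-th term the same
    factor as in [diff_op_slash], so the two expansions compare term by term. *)
Lemma slash_diff_op k K n a f g tau :
  slash (k + K%:~R) (diff_op n a f) g tau =
  \sum_(r < n.+1) cpow (automorphy g tau) (- k - 2 * r%:R) *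
    iter r (@D R) f (mobius g tau) *
    slash (K - 2 * r%:Z)%:~R (a r) g tau.
Proof.
rewrite /slash /diff_op mulr_sumr; apply: eq_bigr => r _.
have -> : - (k + K%:~R) = (- k - 2 * r%:R) + - (K - 2 * r%:Z)%:~R :> R.
  by rewrite intrB intrM; ring.
by rewrite cpowD; ring.
Qed.

Lemma diff_op_pow n a w m :
  diff_op n a (fun z => (z - w) ^+ m) w =
  if (m <= n)%N then (twopii R)^-1 ^+ m * m`!%:R * a m w else 0.
Proof.
rewrite /diff_op; under eq_bigr => r _ do rewrite iterD_pow_center.
case: ifPn => mn.
  rewrite (bigD1 (Ordinal (mn : (m < n.+1)%N))) //= eqxx big1 ?addr0; first by rewrite mulrC.
  by move=> r; rewrite -val_eqE /= => /negPf ->; rewrite mulr0.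
apply: big1 => r _; case: eqP => [rm|]; last by rewrite mulr0.
by move: mn; rewrite -rm -ltnS ltn_ord.
Qed.

Lemma pow_scale_neq0 m : (twopii R)^-1 ^+ m * m`!%:R != 0 :> C.
Proof.
by rewrite mulf_neq0 ?expf_neq0 ?invr_neq0 ?twopii_neq0 // pnatr_eq0 -lt0n fact_gt0.
Qed.

Lemma equivariant_coefficient_law G k K n a : (forall g, G g -> \det g = 1) ->
  equivariant G k K (diff_op n a) <-> coefficient_law G k K n a.
Proof.
move=> detG; split=> [eqv r rn tau it g Gg|law f g hf Gg tau it]; last first.
  rewrite (diff_op_slash _ _ _ (detG _ Gg) hf it) slash_diff_op; apply: eq_bigr => r _.
  by rewrite law // -ltnS.
(* The test function is centred at [mobius g tau], where both expansions evaluate the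
   derivatives. *)
have dg := detG _ Gg; pose p z := (z - mobius g tau) ^+ r.
have hp : holomorphic_upper p by exact: holomorphic_pow.
have := eqv p g hp Gg tau it; rewrite (diff_op_slash _ _ _ dg hp it) slash_diff_op.
have single (F : nat -> C) : \sum_(i < n.+1) cpow (automorphy g tau) (- k - 2 * i%:R) *
    iter i (@D R) p (mobius g tau) * F i =
    cpow (automorphy g tau) (- k - 2 * r%:R) * ((twopii R)^-1 ^+ r * r`!%:R) * F r.
  rewrite (bigD1 (Ordinal (rn : (r < n.+1)%N))) //= big1 ?addr0 ?iterD_pow_center ?eqxx //.
  by move=> i; rewrite -val_eqE iterD_pow_center /= => /negPf ->; rewrite mulr0 mul0r.
rewrite (single (fun r => transformed_coef k n a g r tau)).
rewrite (single (fun r => slash (K - 2 * r%:Z)%:~R (a r) g tau)) => /mulfI; rewrite mulf_neq0 ?cpow_neq0 ?pow_scale_neq0 //.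
by move=> /(_ isT) <-.
Qed.

(** Evaluation on [(z - tau) ^+ r] at [tau] reads off the [r]-th coefficient; the two orders may
    differ, in which case the surplus coefficients vanish. *)
Lemma diff_op_coef_unique n n' a b :
  (forall f, holomorphic_upper f -> forall tau, upper tau ->
     diff_op n a f tau = diff_op n' b f tau) ->
  forall r tau, (r <= n)%N -> upper tau ->
    a r tau = if (r <= n')%N then b r tau else 0.
Proof.
move=> ab r tau rn it; have := ab _ (@holomorphic_pow R tau r) tau it.
rewrite !diff_op_pow rn; case: ifP => _; first by move/(mulfI (pow_scale_neq0 r)).
by move/eqP; rewrite mulf_eq0 (negPf (pow_scale_neq0 r)) => /eqP.
Qed.

Lemma holomorphic_at_cusps_eq G (x : R) f (h : C -> C) :
  (forall tau, upper tau -> f tau = h tau) ->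
  holomorphic_at_cusps G x h -> holomorphic_at_cusps G x f.
Proof.
move=> fh hh sigma cs; have [A [M AM]] := hh sigma cs.
(* The maximum with 0 forces [tau] into the upper half-plane, where the two functions agree. *)
exists (Num.max A 0), M => tau; rewrite gt_max => /andP[At it].
by rewrite /slash fh; [exact: AM|exact: mobius_upper (cs.1) it].
Qed.

Lemma holomorphic_at_cusps0 G (x : R) : holomorphic_at_cusps G x (fun=> 0 : C).
Proof. by move=> sigma _; exists 0, 0 => tau _; rewrite /slash mulr0 modulus0. Qed.

End Equivariance.

(** The coefficient law does not mention the cusps, whereas [mldo] includes a condition there. The
    first equivalence therefore carries that condition explicitly, and the second concerns
    equivariance alone. *)
Theorem theorem5 (R : realType) (G : set 'M[R]_2) (k : R) (K : int)
    (n : nat) (a : nat -> Cplx R -> Cplx R) :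
  lattice G ->
  (forall r, (r <= n)%N -> holomorphic_upper (a r)) ->
  (mldo G k K (diff_op n a) <->
     coefficient_law G k K n a /\
     (forall r, (r <= n)%N ->
        holomorphic_at_cusps G (K - 2 * r%:Z)%:~R (a r)))
  /\
  (equivariant G k K (diff_op n a) <-> coefficient_law G k K n a).
Proof.
move=> [[detG _ _ _] _ _] ha.
have eqv := equivariant_coefficient_law k K n a detG.
split; last exact: eqv.
split=> [[[n' [b [hb cb Lb]]] /eqv law]|[law ca]]; last first.
  by split; [exists n, a; split|apply/eqv].
(* [mldo] provides its own order [n'] and coefficients [b]; uniqueness transfers the cusp condition
   from [b] to [a], and [a r] vanishes on the upper half-plane when [r] exceeds [n']. *)
split=> // r rn; have ab := diff_op_coef_unique Lb rn.
have [rn'|rn'] := boolP (r <= n')%N; rewrite ?rn' ?(negPf rn') in ab.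
  exact: holomorphic_at_cusps_eq ab (cb r rn').
exact: (holomorphic_at_cusps_eq (h := fun=> 0) ab (@holomorphic_at_cusps0 _ G _)).
Qed.
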